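(* Let $R:\mathbb{R}\to\mathbb{C}$ satisfy the following conditions: 1) $R$ is even; 2) $R(x)\to 0$ as $x\to+\infty$; 3) $R$ is absolutely continuous on every segment $[0,a]$, $a>0$; 4) $R'\in L_1(0,\infty)$; 5) there exists a number $b\ge 0$ such that (a) $\displaystyle\int_1^\infty\frac{|g(t)|}{t}\,dt<\infty$, where $\displaystyle g(t)=\int_0^b R'(x)\sin(xt)\,dx$; (b) there exists an extension of the (almost everywhere defined) derivative $R'$ to the whole real axis such that $R'$ has bounded variation on $[b,\infty)$ and $\displaystyle\int_b^\infty\Big(\bigvee_x^\infty R'\Big)\,dx<\infty$. Then $R\in\mathcal{F}(\mathbb{R})$.
   Context: $\mathcal{F}(\mathbb{R})$ is the set (an algebra under pointwise operations) of all functions on $\mathbb{R}$ of the form $\widehat f(x)=\frac{1}{\sqrt{2\pi}}\int_{-\infty}^{\infty}f(t)e^{-ixt}\,dt$ with $f\in L_1(-\infty,\infty)$. The symbol $\bigvee_a^b f$ denotes the total variation of $f$ on the interval with endpoints $a,b$; $\bigvee_x^\infty f$ is the total variation on $[x,\infty)$. *)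

(* Defs.v *)
From HB Require Import structures.
From mathcomp Require Import all_boot all_order all_algebra.
From mathcomp Require Import complex.
From mathcomp Require Import all_classical all_reals all_analysis.

Set Implicit Arguments.
Unset Strict Implicit.
Unset Printing Implicit Defensive.

Import Order.TTheory GRing.Theory Num.Theory.
Import numFieldNormedType.Exports.

Local Open Scope classical_set_scope.
Local Open Scope ring_scope.
Local Open Scope complex_scope.

Section ComplexValued.
Context {K : realType}.
Implicit Types (f : K -> K[i]) (D : set K).

(* [normc] is the modulus with values in [K]; the norm [`|z|] of the
   numDomainType [K[i]] would take its values in [K[i]]. *)
Definition cmod (z : K[i]) : K := ComplexField.Normc.normc z.

Definition expi (y : K) : K[i] := cos y +i* sin y.

Definition cderivable f (x : K) : Prop :=
  derivable (fun y => complex.Re (f y)) x 1 /\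
  derivable (fun y => complex.Im (f y)) x 1.

(* Meaningful only where [cderivable f x] holds: a component that is not
   derivable at [x] gets the default value of [lim].  For continuous [f] the
   set of such points is Borel, so measurability is unaffected. *)
Definition cderive1 f (x : K) : K[i] :=
  derive1 (fun y => complex.Re (f y)) x +i* derive1 (fun y => complex.Im (f y)) x.

(* Measurability here is with respect to the Borel sets, which loses nothing
   for L_1: every Lebesgue measurable function agrees a.e. with a Borel one. *)
Definition cintegrable D f : Prop :=
  (@lebesgue_measure K).-integrable D (fun t => (complex.Re (f t))%:E) /\
  (@lebesgue_measure K).-integrable D (fun t => (complex.Im (f t))%:E).

Definition cintegral D f : K[i] :=
  (\int[@lebesgue_measure K]_(t in D) complex.Re (f t)) +i*
  (\int[@lebesgue_measure K]_(t in D) complex.Im (f t)).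

Definition abs_continuous (a b : K) f : Prop :=
  forall e : K, 0 < e -> exists2 d : K, 0 < d &
    forall (n : nat) (u v : 'I_n -> K),
      (forall i, [/\ a <= u i, u i <= v i & v i <= b]) ->
      trivIset [set: 'I_n] (fun i => `]u i, v i[%classic) ->
      \sum_(i < n) (v i - u i) < d ->
      \sum_(i < n) cmod (f (v i) - f (u i)) < e.

Definition cvariation (a b : K) f (s : seq K) : K :=
  \sum_(n < size s) cmod (f (nth b (a :: s) n.+1) - f (nth b (a :: s) n)).

(* [itv_partition a b s] excludes [a] from [s]; for [b < a] there is no
   partition and the supremum is [-oo]. *)
Definition ctotal_variation (a b : K) f : \bar K :=
  ereal_sup [set (cvariation a b f s)%:E | s in itv_partition a b].

Definition ctotal_variation_infty (a : K) f : \bar K :=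
  ereal_sup [set ctotal_variation a c f | c in `[a, +oo[%classic].

Definition fourier f (x : K) : K[i] :=
  ((Num.sqrt (2 * pi))^-1)%:C *
  cintegral [set: K] (fun t => f t * expi (- (x * t))).

Definition fourier_algebra : set (K -> K[i]) :=
  [set fourier f | f in [set f | cintegrable [set: K] f]].

End ComplexValued.

(* Main.v *)
Require Import Defs.
From HB Require Import structures.
From mathcomp Require Import all_boot all_order all_algebra.
From mathcomp Require Import complex.
From mathcomp Require Import all_classical all_reals all_analysis.
From mathcomp Require Import measurable_realfun ring lra.

Set Implicit Arguments.
Unset Strict Implicit.
Unset Printing Implicit Defensive.

Import Order.TTheory GRing.Theory Num.Theory.
Import numFieldNormedType.Exports.

Local Open Scope classical_set_scope.
Local Open Scope ring_scope.
Local Open Scope complex_scope.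

(** Write [R(x) = - int_x^oo R'] on the half-line, by absolute continuity, and put
    [G(t) = int_0^oo R'(u) sin(ut) du].  Integrating the cosine transform of [R]
    by parts suggests that [R] is the Fourier transform of the even function equal
    to a constant multiple of [- G(t) / t] for [t > 0].

    [G(t) / t] is integrable: the part of [G] over [[0, b]] is [O(t)] near [0] and
    is controlled by (a) at infinity; on [[b, oo)], each component of [R'] is half
    the difference of [V + R'] and [V - R'], where [V] is the tail variation, and
    both are nonincreasing and integrable.  For such a [W] and [c >= b],
    [|int_c^oo W(u) sin(ut) du| <= pi W(c) / t]; with [c = b] this settles
    [t >= 1], and with [c = b + 1/t] it reduces [t <= 1] to Tonelli's theorem for
    [u W(u)] on [b < u <= b + 1/t].

    The inversion [int_0^oo cos(xt) G(t) / t dt = pi/2 int_x^oo R'] follows from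
    Fubini's theorem after multiplying by [exp(-t/n) - exp(-nt)]: the inner
    integrals are differences of arctangents, which are bounded and converge. *)

(** * Absolutely continuous functions and their variation *)

(** [R] need not be integrable, so its cosine transform is only heuristic: the proof starts from the
    function built from [G] and recovers [R] by inversion. A direct exchange of integrals is not
    justified, because [|sin (u * t)| / t] has infinite integral at infinity; after smoothing, the
    kernel in [t] is integrable uniformly in [u], and its sine transform tends to [pi / 2] times a
    sign. Writing [sin (u * t) * cos (x * t)] as a half-sum of sines at [u + x] and [u - x], the
    signs cancel for [0 < u < x] and add up for [u > x], which produces the tail integral.

    Absolute continuity is given by epsilon and delta and has to be converted into an integral of
    the derivative. For a real [f] with variation function [T], both [T] and [T - f] are
    nondecreasing and absolutely continuous, so their Stieltjes measures have densities by the
    Radon-Nikodym theorem. The real and imaginary parts of [R] are treated separately: they inherit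
    all hypotheses because they are bounded by the modulus. *)

Section absolute_continuity_of_the_variation.
Context {K : realType}.
Implicit Types (a b x y : K) (f : K -> K) (s : seq (K * K)).

Definition nonoverlapping (p q : K * K) := (p.2 <= q.1) || (q.2 <= p.1).

Definition segments_in a b s := all (fun p => [&& a <= p.1, p.1 <= p.2 & p.2 <= b]) s.

(* Lists of segments with non-overlapping interiors replace the indexed
   families of [abs_continuous]: they can be refined by concatenation. *)
Definition abs_cont a b f := forall e : K, 0 < e -> exists2 d : K, 0 < d &
  forall s, segments_in a b s -> pairwise nonoverlapping s ->
    \sum_(p <- s) (p.2 - p.1) < d -> \sum_(p <- s) `|f p.2 - f p.1| < e.

Lemma nonoverlappingC p q : nonoverlapping p q = nonoverlapping q p.
Proof. by rewrite /nonoverlapping orbC. Qed.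

Lemma steps_in x l : path <%R x l -> segments_in x (last x l) (pairmap pair x l).
Proof.
elim: l x => //= y l IH x /andP[xy pl]; rewrite lexx (ltW xy)/=.
have yl : y <= last y l.
  elim: l y pl {IH xy} => //= z l IH y /andP[yz /IH]; exact/le_trans/ltW.
rewrite yl/=; apply: sub_all (IH _ pl) => p /and3P[yp -> ->].
by rewrite (le_trans (ltW xy)).
Qed.

Lemma steps_nonoverlapping x l : path <%R x l ->
  pairwise nonoverlapping (pairmap pair x l).
Proof.
elim: l x => //= y l IH x /andP[xy pl]; rewrite IH// andbT.
apply: sub_all (steps_in pl) => p /and3P[yp _ _].
by rewrite /nonoverlapping/= yp.
Qed.

Lemma sum_steps_length x l :
  \sum_(p <- pairmap pair x l) (p.2 - p.1) = last x l - x.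
Proof.
elim: l x => [x|y l IH x] /=; first by rewrite big_nil subrr.
by rewrite big_cons/= IH; ring.
Qed.

Lemma variation_steps a b f l : itv_partition a b l ->
  variation a b f l = \sum_(p <- pairmap pair a l) `|f p.2 - f p.1|.
Proof.
move=> /variation_zip ->; elim: l a => [a|y l IH a] /=; first by rewrite !big_nil.
by rewrite !big_cons/= IH.
Qed.

(* Each segment of [s1] is in turn replaced by the steps of an arbitrary
   partition of it, which join [s2]. *)
Lemma sum_total_variation_le a b f (e d : K) :
  (forall s, segments_in a b s -> pairwise nonoverlapping s ->
    \sum_(p <- s) (p.2 - p.1) < d -> \sum_(p <- s) `|f p.2 - f p.1| <= e) ->
  forall s1 s2, segments_in a b (s1 ++ s2) -> pairwise nonoverlapping (s1 ++ s2) ->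
    \sum_(p <- s1 ++ s2) (p.2 - p.1) < d ->
  (\sum_(p <- s1) total_variation p.1 p.2 f +
   (\sum_(p <- s2) `|f p.2 - f p.1|)%:E <= e%:E)%E.
Proof.
move=> ace; elim => [|p s1 IH] s2.
  by rewrite cat0s big_nil add0e lee_fin; exact: ace.
rewrite /= big_cons big_cons => /andP[/and3P[ap p12 pb] s12ab] /andP[ps s12n] ltd.
have C0 : (0 <= \sum_(q <- s1) total_variation q.1 q.2 f +
   (\sum_(q <- s2) `|f q.2 - f q.1|)%:E)%E.
  apply: adde_ge0; last by rewrite lee_fin sumr_ge0.
  rewrite big_seq; apply: sume_ge0 => q qs1; apply: total_variation_ge0.
  move: s12ab; rewrite /segments_in all_cat => /andP[/allP/(_ _ qs1)].
  by case/and3P.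
rewrite -addeA.
(* Finiteness allows the rest of the sum to be moved to the right, after which the supremum defining
   the variation on [p] is bounded one partition at a time. *)
have Cfin : (\sum_(q <- s1) total_variation q.1 q.2 f +
   (\sum_(q <- s2) `|f q.2 - f q.1|)%:E)%E \is a fin_num.
  rewrite ge0_fin_numE//; apply: le_lt_trans (ltry e); apply: IH => //.
  by apply: le_lt_trans ltd; rewrite lerDr subr_ge0.
rewrite -leeBrDr//; apply: ge_ereal_sup => _ [v [l pl <-] <-].
rewrite leeBrDr// addeCA -EFinD variation_steps// -big_cat/=.
have [pathl /eqP lastl] := pl.
apply: IH.
- move: s12ab; rewrite /segments_in !all_cat => /andP[-> ->]; rewrite andbT/=.
  apply: sub_all (steps_in pathl) => q /and3P[aq -> qb].
  by rewrite (le_trans ap)// (le_trans qb)// lastl.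
- move: s12n; rewrite !pairwise_cat => /and3P[r12 -> ->]; rewrite !andbT.
  rewrite (steps_nonoverlapping pathl) andbT/=.
  have H q r : q \in pairmap pair p.1 l -> r \in s1 ++ s2 -> nonoverlapping q r.
    move=> /(allP (steps_in pathl))/and3P[q1 _ q2] /(allP ps).
    rewrite lastl in q2.
    by move=> /orP[pr|pr]; apply/orP; [left; rewrite (le_trans q2)|
      right; rewrite (le_trans pr)].
  rewrite allrel_catr r12 andbT; apply/andP; split.
    apply/allrelP => r q rs ql; rewrite nonoverlappingC; apply: H => //.
    by rewrite mem_cat rs.
  apply/allrelP => q r ql rs; apply: H => //.
  by rewrite mem_cat rs orbT.
- rewrite big_cat/= big_cat/= sum_steps_length lastl addrCA -big_cat//.
Qed.

(** With [d] the tolerance for [e = 1], a segment shorter than [d] has variation at most 1, and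
    finitely many steps of length [d / 2] lead from [x] to [y]. *)
Lemma abs_cont_total_variation_fin a b f : abs_cont a b f ->
  forall x y, a <= x -> x <= y -> y <= b -> total_variation x y f \is a fin_num.
Proof.
move=> /(_ 1 ltr01)[d d0 acd] x y ax xy yb.
have short u v : a <= u -> u <= v -> v <= b -> v - u < d ->
    (total_variation u v f <= 1%:E)%E.
  move=> au uv vb uvd.
  have := @sum_total_variation_le a b f 1 d _ [:: (u, v)] [::].
  rewrite cats0 !big_seq1 big_nil adde0/= au uv vb; apply => //.
  by move=> s s1 s2 s3; exact/ltW/acd.
have {short}step n z : x <= z -> z <= b -> z <= x + n%:R * (d / 2) ->
    (total_variation x z f < +oo)%E.
  elim: n z => [z xz zb|n IH z xz zb zn].
    rewrite mul0r addr0 => zx; have -> : z = x by apply/eqP; rewrite eq_le zx.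
    by rewrite total_variationxx ltry.
  (* Going back by [d / 2] keeps the last piece strictly shorter than [d]; the maximum stops at
     [x]. *)
  pose w := Num.max x (z - d / 2).
  have xw : x <= w by rewrite le_max lexx.
  have wz : w <= z by rewrite ge_max xz gerBl ltW// divr_gt0.
  rewrite (total_variationD f xw wz) lte_add_pinfty//.
    apply: IH => //; first exact: le_trans zb.
    rewrite ge_max lerDl mulr_ge0 ?ler0n//= ?divr_ge0// ?(ltW d0)//.
    by move: zn; rewrite -natr1 mulrDl mul1r; lra.
  apply: le_lt_trans (ltry 1); apply: short => //.
    exact: le_trans xw.
  have : z - d / 2 <= w by rewrite le_max lexx orbT.
  lra.
rewrite ge0_fin_numE ?total_variation_ge0//.
apply: (step (Num.truncn ((y - x) / (d / 2))).+1) => //.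
rewrite -lerBlDl -ler_pdivrMr ?divr_gt0//; apply/ltW/truncnS_gt.
Qed.

Definition running_variation a f x := fine (total_variation a x f).

Lemma running_variationB a b f x y : abs_cont a b f ->
  a <= x -> x <= y -> y <= b ->
  ((running_variation a f y - running_variation a f x)%:E =
  total_variation x y f)%E.
Proof.
move=> ac ax xy yb; have fin := abs_cont_total_variation_fin ac.
rewrite EFinB !fineK; first last.
- by apply: fin => //; exact: le_trans ax xy.
- by apply: fin => //; exact: le_trans xy yb.
rewrite (total_variationD f ax xy) addeAC subee ?add0e//.
by apply: fin => //; exact: le_trans xy yb.
Qed.

(** By [sum_total_variation_le] a tolerance that serves [f] also serves its variation; passing to
    suprema weakens [<] to [<=], so the tolerance is taken for [e / 2]. *)
Lemma abs_cont_running_variation a b f : abs_cont a b f ->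
  abs_cont a b (running_variation a f).
Proof.
move=> ac e e0; have e20 : 0 < e / 2 by rewrite divr_gt0.
have [d d0 acd] := ac _ e20; exists d => // s sab sn sd.
apply: (@le_lt_trans _ _ (e / 2)); last by rewrite ltr_pdivrMr// mulr_natr mulr2n ltrDl.
have := @sum_total_variation_le a b f (e / 2) d _ s [::].
rewrite cats0 big_nil adde0 => /(_ _ sab sn sd); rewrite -lee_fin.
have -> : (\sum_(p <- s) total_variation p.1 p.2 f =
    (\sum_(p <- s) `|running_variation a f p.2 - running_variation a f p.1|)%:E)%E.
  rewrite -sumEFin big_seq [RHS]big_seq; apply: eq_bigr => p /(allP sab)/and3P[ap pp pb].
  rewrite -(running_variationB ac)// ger0_norm// -lee_fin.
  by rewrite (running_variationB ac)// total_variation_ge0.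
by apply => t t1 t2 t3; exact/ltW/acd.
Qed.

Lemma abs_contB a b f g : abs_cont a b f -> abs_cont a b g ->
  abs_cont a b (fun x => f x - g x).
Proof.
move=> acf acg e e0; have e20 : 0 < e / 2 by rewrite divr_gt0.
have [d1 d10 H1] := acf _ e20; have [d2 d20 H2] := acg _ e20.
exists (Num.min d1 d2); first by rewrite lt_min d10.
move=> s sab sn; rewrite lt_min => /andP[sd1 sd2].
apply: le_lt_trans (_ : \sum_(p <- s) `|f p.2 - f p.1| +
    \sum_(p <- s) `|g p.2 - g p.1| < e).
  rewrite -big_split/=; apply: ler_sum => p _.
  have -> : f p.2 - g p.2 - (f p.1 - g p.1) = (f p.2 - f p.1) - (g p.2 - g p.1).
    by ring.
  exact: ler_normB.
by rewrite [ltRHS]splitr ltrD// ?H1// H2.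
Qed.

Lemma running_variation_nd a b f : abs_cont a b f ->
  {in `[a, b] &, {homo running_variation a f : x y / x <= y}}.
Proof.
move=> ac x y; rewrite !in_itv/= => /andP[ax xb] /andP[ay yb] xy.
by rewrite -subr_ge0 -lee_fin (running_variationB ac)// total_variation_ge0.
Qed.

(** Second half of the Jordan decomposition: an increment of [f] is at most its variation. *)
Lemma running_variationB_nd a b f : abs_cont a b f ->
  {in `[a, b] &, {homo (fun x => running_variation a f x - f x) : x y / x <= y}}.
Proof.
move=> ac x y; rewrite !in_itv/= => /andP[ax xb] /andP[ay yb] xy.
have : (f y - f x <= running_variation a f y - running_variation a f x)%R.
  rewrite -lee_fin (running_variationB ac)//.
  by apply: le_trans (total_variation_ge _ xy); rewrite lee_fin ler_norm.
lra.
Qed.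

End absolute_continuity_of_the_variation.

(** * Density of a nondecreasing absolutely continuous function *)

Section density.
Context {K : realType}.
Notation mu := (@lebesgue_measure K).
Implicit Types (a b x y l r : K) (I : set K) (F : K -> K).

(** A nonempty open interval contains neither its infimum nor its supremum. The pair [(a, a)] stands
    for the empty set: at the left end, the degenerate segment overlaps no other. *)
Lemma open_interval_endpoints I a b : open I -> is_interval I ->
    I `<=` `[a, b] -> a <= b ->
  exists p : K * K, [/\ [&& a <= p.1, p.1 <= p.2 & p.2 <= b],
    I = `]p.1, p.2[%classic & p.1 < p.2 \/ p = (a, a)].
Proof.
move=> oI iI Iab ab; have [->|/set0P[z Iz]] := eqVneq I set0.
  by exists (a, a); split => //=; [rewrite lexx ab|rewrite set_itvE|right].
have lbI : has_lbound I by exists a => x /Iab/=; rewrite in_itv/= => /andP[].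
have ubI : has_ubound I by exists b => x /Iab/=; rewrite in_itv/= => /andP[].
have I0 : I !=set0 by exists z.
have Iooo x : I x -> inf I < x < sup I.
  move=> Ix; have [e /= e0 xe] := (nbhs_ballP _ _).1 (open_nbhs_nbhs (conj oI Ix)).
  have e2 : `|e / 2| < e by rewrite ger0_norm ?divr_ge0 ?ltW// ltr_pdivrMr//
    mulr_natr mulr2n ltrDl.
  have I1 : I (x - e / 2) by apply: xe; rewrite /ball/= opprB addrCA subrr addr0.
  have I2 : I (x + e / 2) by apply: xe; rewrite /ball/= opprD addNKr normrN.
  have := ge_inf lbI I1; have := ub_le_sup ubI I2.
  by move=> h1 h2; apply/andP; split; move: h1 h2 e0; lra.
exists (inf I, sup I); split => /=.
- have /andP[z1 z2] := Iooo _ Iz.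
  rewrite (ltW (lt_trans z1 z2)) /=; apply/andP; split.
    by apply: lb_le_inf => // x /Iab/=; rewrite in_itv/= => /andP[].
  by apply: ge_sup => // x /Iab/=; rewrite in_itv/= => /andP[].
- apply/seteqP; split => x /=; rewrite in_itv/=; first exact: Iooo.
  move=> /andP[/(inf_lt I0)[u Iu ux] /(sup_gt I0)[v Iv xv]].
  by apply: (iI _ _ Iu Iv); rewrite (ltW ux) ltW.
- by left; have /andP[z1 z2] := Iooo _ Iz; exact: lt_trans z2.
Qed.

(** Absolute continuity controls finite families only; the bound on partial sums is uniform in [n],
    so it survives the passage to a countable family. Disjointness of the open intervals has to be
    turned into an order of endpoints. *)
Lemma abs_cont_itv_cover a b F (e d : K) (I : nat -> set K) :
    (forall s, segments_in a b s -> pairwise nonoverlapping s ->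
      \sum_(p <- s) (p.2 - p.1) < d -> \sum_(p <- s) `|F p.2 - F p.1| < e) ->
    a <= b -> (forall k, open (I k) /\ is_interval (I k)) ->
    trivIset setT I -> (forall k, I k `<=` `[a, b]) ->
    (mu (\bigcup_k I k) < d%:E)%E ->
  exists p : nat -> K * K,
   [/\ forall k, [&& a <= (p k).1, (p k).1 <= (p k).2 & (p k).2 <= b],
       forall k, I k = `](p k).1, (p k).2[%classic &
       forall n, \sum_(0 <= k < n) `|F (p k).2 - F (p k).1| < e].
Proof.
move=> ac ab oiI tI Iab mud.
have /choice[p pP] k := open_interval_endpoints (oiI k).1 (oiI k).2 (Iab k) ab.
exists p; split; [by move=> k; have [] := pP k|by move=> k; have [] := pP k|].
move=> n.
have mI k : measurable (I k) by have [_ -> _] := pP k; exact: measurable_itv.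
have no i j : i != j -> nonoverlapping (p i) (p j).
  move=> ij; rewrite /nonoverlapping.
  have [/and3P[ai pi ib] Ii [lti|eqi]] := pP i; last first.
    by have [/and3P[aj _ _] _ _] := pP j; rewrite eqi/= aj.
  have [/and3P[aj pj jb] Ij [ltj|eqj]] := pP j; last first.
    by rewrite eqj/= ai orbT.
  rewrite leNgt [X in _ || X]leNgt -negb_and; apply/negP => /andP[h1 h2].
  (* Two overlapping nondegenerate segments would share the interval from [u] to [v], whose midpoint
     lies in both [I i] and [I j]. *)
  pose u := Num.max (p i).1 (p j).1; pose v := Num.min (p i).2 (p j).2.
  have uv : u < v by rewrite lt_min !gt_max lti ltj h1 h2.
  have [u1 u2] : (p i).1 <= u /\ (p j).1 <= u by rewrite !le_max !lexx orbT.
  have [v1 v2] : v <= (p i).2 /\ v <= (p j).2 by rewrite !ge_min !lexx orbT.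
  have /trivIsetP/(_ i j Logic.I Logic.I ij) := tI; apply/eqP/set0P.
  exists ((u + v) / 2); rewrite Ii Ij; split => /=; rewrite in_itv/=.
    by move: uv u1 v1; lra.
  by move: uv u2 v2; lra.
have := ac [seq p k | k <- index_iota 0 n]; rewrite !big_map; apply.
- by apply/allP => q /mapP[k _ ->]; have [] := pP k.
- rewrite pairwise_map; have := iota_uniq 0 (n - 0); rewrite uniq_pairwise.
  by apply: sub_pairwise => i j /=; exact: no.
- rewrite -lte_fin; apply: le_lt_trans mud.
  apply: (@le_trans _ _ (mu (\big[setU/set0]_(k < n) I k))); last first.
    apply: le_measure; rewrite ?inE.
    + by apply: bigsetU_measurable => k _; exact: mI.
    + by apply: bigcup_measurable => k _; exact: mI.
    + exact: bigsetU_bigcup.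
  rewrite measure_bigsetU//.
  rewrite -sumEFin big_mkord; apply: lee_sum => k _.
  have [/and3P[_ pk _] Ik _] := pP k;
    rewrite -[leRHS]/(mu (I k)) Ik lebesgue_measure_itv/= lte_fin;
    case: ifPn => // /negbTE h.
  by rewrite lee_fin subr_le0 leNgt h.
Qed.

Lemma abs_cont_continuity a b F (e : K) : abs_cont a b F -> 0 < e ->
  exists2 d : K, 0 < d & forall x y, a <= x -> x <= y -> y <= b ->
    y - x < d -> `|F y - F x| < e.
Proof.
move=> ac /ac[d d0 H]; exists d => // x y ax xy yb yxd.
have := H [:: (x, y)]; rewrite !big_seq1/= ax xy yb; exact.
Qed.

(** The density is the Radon-Nikodym derivative of the Lebesgue-Stieltjes measure of [F] on the open
    interval []a, b[], hence the restriction [y < b]. *)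
Lemma nd_abs_cont_density a b F : a < b ->
    {in `[a, b] &, {homo F : x y / x <= y}} -> abs_cont a b F ->
  exists2 p : K -> K, mu.-integrable setT (EFin \o p) &
    forall x y, a <= x -> x <= y -> y < b ->
      F y - F x = \int[mu]_(t in `]x, y]) p t.
Proof.
move=> ab ndF ac.
(* A cumulative function lives on the whole line: composition with the projection [cl] onto [[a, b]]
   extends [F] by constants. *)
pose cl x := Num.max a (Num.min x b).
have clab x : cl x \in `[a, b].
  by rewrite in_itv/= le_max lexx/= ge_max ge_min lexx orbT (ltW ab).
have cl_nd x y : x <= y -> cl x <= cl y.
  by move=> xy; rewrite /cl ge_max !le_max lexx/= le_min !ge_min xy lexx !orbT.
have clB x y : x <= y -> cl y - cl x <= y - x.
  rewrite /cl /Num.max /Num.min; do 4 case: ifPn; lra.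
have clK x : a <= x -> x <= b -> cl x = x.
  by move=> ax xb; rewrite /cl min_l// max_r.
pose Fc := F \o cl.
have Fc_nd : {homo Fc : x y / x <= y} by move=> x y xy; apply: ndF => //; exact: cl_nd.
have Fc_rc : right_continuous Fc.
  move=> x; apply/cvgrPdist_lt => e e0.
  have [d d0 H] := abs_cont_continuity ac e0.
  near=> y; rewrite distrC.
  have xy : x <= y by near: y; exact: nbhs_right_ge.
  have := clab x; have := clab y; rewrite !in_itv/= => /andP[_ yb] /andP[ax _].
  apply: H => //; first exact: cl_nd.
  apply: le_lt_trans (clB _ _ xy) _; rewrite ltrBlDl.
  by near: y; apply: nbhs_right_lt; rewrite ltrDl.
pose FcM := isCumulative.Build K _ K Fc Fc_nd Fc_rc.
pose G : cumulative K K := HB.pack Fc FcM.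
pose nu0 := lebesgue_stieltjes_measure G.
have nu0oc x y : x <= y -> nu0 `]x, y]%classic = (Fc y - Fc x)%:E.
  move=> xy; rewrite /nu0 /lebesgue_stieltjes_measure /measure_extension.
  by rewrite measurable_mu_extE/=; [rewrite wlength_itv_bnd|exact: is_ocitv].
pose D : set K := `]a, b[%classic.
have mD : measurable (D : set (measurableTypeR K)) by exact: measurable_itv.
have nu0D : (nu0 D < +oo)%E.
  apply: (@le_lt_trans _ _ (nu0 `]a, b]%classic)).
    apply: le_measure; rewrite ?inE; [exact: measurable_itv..|].
    by apply: subset_itvl; rewrite bnd_simp.
  by rewrite nu0oc ?ltW// ltry.
pose nu : {finite_measure set (measurableTypeR K) -> \bar K} := mfrestr mD nu0D.
(* Outer regularity puts a null subset of [D] into an open set of measure below [d]; the components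
   of its trace on [D] form a disjoint family to which the epsilon-delta condition applies. *)
have nu_mu : charge_of_finite_measure nu `<< (mu :
  {sigma_finite_measure set (measurableTypeR K) -> \bar K}).
  apply/null_content_dominatesP => A mA muA0.
  rewrite /charge_of_finite_measure/= /mfrestr /mrestr.
  apply/eqP; rewrite -measure_le0; apply/lee_addgt0Pr => e e0; rewrite add0e.
  have [d d0 acd] := ac _ e0.
  have mAD : measurable (A `&` D) by exact: measurableI.
  have muAD : mu (A `&` D) = 0.
    by apply/eqP; rewrite -measure_le0 -muA0 le_measure ?inE//; exact: subIsetl.
  have [U [oU AU Ud]] : exists U : set K,
      [/\ open U, A `&` D `<=` U & (mu (U `\` (A `&` D)) < d%:E)%E].
    by apply: lebesgue_regularity_outer => //; rewrite [ltLHS]muAD ltry.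
  have oUD : open (U `&` D) by apply: openI => //; exact: interval_open.
  have mU : measurable U by exact: open_measurable.
  have mUD : measurable (U `&` D) by exact: open_measurable.
  pose I := open_disjoint_itv oUD.
  have UDI : U `&` D = \bigcup_k I k by exact: open_disjoint_itv_bigcup.
  have [||||p [pab Ip psum]] := @abs_cont_itv_cover a b F e d I acd (ltW ab).
  - move=> k; split; first exact: open_disjoint_itv_open.
    exact: open_disjoint_itv_is_interval.
  - exact: open_disjoint_itv_trivIset.
  - move=> k x Ikx; have : (U `&` D) x by rewrite UDI; exists k.
    by move=> [_]; exact: subset_itv_oo_cc.
  - rewrite -UDI; apply: le_lt_trans Ud.
    have -> : mu (U `\` (A `&` D)) = mu U.
      have := measureDI mu mU mAD.
      rewrite (setIidr AU) => ->.
      by rewrite [X in (_ + X)%E]muAD adde0.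
    by apply: le_measure; [exact/mem_set|exact: mem_set|exact: subIsetl].
  apply: (@le_trans _ _ (nu0 (U `&` D))).
    by apply: le_measure; [exact/mem_set|exact/mem_set|move=> x [Ax Dx];
      split => //; exact: AU].
  have mI k : measurable (I k : set (measurableTypeR K)).
    by rewrite Ip; exact: measurable_itv.
  have -> : nu0 (U `&` D) = (\sum_(i <oo | i \in setT) nu0 (I i))%E.
    rewrite UDI; apply: (@measure_bigcup _ _ _
      (lebesgue_stieltjes_measure G : {measure set (measurableTypeR K) -> \bar K})) => //.
    exact: open_disjoint_itv_trivIset.
  apply: lime_le; first by apply: is_cvg_nneseries.
  apply: nearW => n.
  apply: (@le_trans _ _ (\sum_(0 <= k < n) `|F (p k).2 - F (p k).1|)%:E); last first.
    by rewrite lee_fin ltW.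
  rewrite -sumEFin (eq_bigl xpredT); last by move=> k; rewrite in_setT.
  apply: lee_sum => k _; have /and3P[ap pp pb] := pab k.
  apply: (@le_trans _ _ (nu0 `](p k).1, (p k).2]%classic)).
    rewrite Ip; apply: le_measure; rewrite ?inE; [exact: measurable_itv..|].
    by apply: subset_itvl; rewrite bnd_simp.
  rewrite nu0oc// lee_fin /Fc/= !clK ?ler_norm//; [exact: le_trans pb|exact: le_trans pp].
pose p := Radon_Nikodym (charge_of_finite_measure nu) (mu :
  {sigma_finite_measure set (measurableTypeR K) -> \bar K}).
have pfin x : p x \is a fin_num by exact: Radon_Nikodym_fin_num.
have ip : mu.-integrable setT p by exact: Radon_Nikodym_integrable.
have pE : EFin \o (fine \o p) = p by apply/funext => x /=; rewrite fineK.
exists (fine \o p); first by rewrite pE.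
move=> x y ax xy yb.
have xyD : `]x, y]%classic `<=` D.
  by apply: subset_itvSoo; rewrite bnd_simp.
have RN : nu0 `]x, y]%classic = (\int[mu]_(t in `]x, y]) p t)%E.
  have <- : charge_of_finite_measure nu `]x, y]%classic = nu0 `]x, y]%classic.
    by rewrite /charge_of_finite_measure/= /mfrestr /mrestr setIidl.
  exact: (Radon_Nikodym_integral nu_mu (measurable_itv `]x, y])).
move: RN; rewrite nu0oc// /Fc/= !clK//; last 3 first.
  exact/ltW/(le_lt_trans xy).
  exact: le_trans ax xy.
  exact/ltW.
rewrite /Rintegral => h; rewrite -[LHS]/(fine (F y - F x)%:E) h; congr fine.
by apply: eq_integral => t _ /=; rewrite fineK.
Unshelve. all: by end_near. Qed.

End density.

(** * Fundamental theorem of calculus for absolutely continuous functions *)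

Section fundamental_theorem.
Context {K : realType}.
Notation mu := (@lebesgue_measure K).
Implicit Types (a b x y : K) (f : K -> K).

(** The densities of the two Jordan parts are subtracted; Lebesgue differentiation ([FTC1])
    identifies the difference with the derivative almost everywhere. *)
Lemma abs_cont_density a f : 0 < a -> abs_cont 0 a f ->
  exists q : K -> K, [/\ mu.-integrable setT (EFin \o q),
    forall x y, 0 <= x -> x <= y -> y < a ->
      f y - f x = \int[mu]_(t in `]x, y]) q t &
    {ae mu, forall x, 0 < x < a -> derivable f x 1 /\ derive1 f x = q x}].
Proof.
move=> a0 ac; have acT := abs_cont_running_variation ac.
have [p1 ip1 p1E] := nd_abs_cont_density a0 (running_variation_nd ac) acT.
have [p2 ip2 p2E] := nd_abs_cont_density a0 (running_variationB_nd ac) (abs_contB acT ac).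
have ip x y (p : K -> K) : mu.-integrable setT (EFin \o p) ->
  mu.-integrable `]x, y] (EFin \o p) by exact: integrableS.
have iq : mu.-integrable setT (EFin \o (fun t => p1 t - p2 t)).
  by rewrite /comp; under eq_fun do rewrite EFinB; exact: integrableB.
have qE x y : 0 <= x -> x <= y -> y < a ->
    f y - f x = \int[mu]_(t in `]x, y]) (p1 t - p2 t).
  move=> x0 xy ya; rewrite RintegralB; [|by []|exact: ip|exact: ip].
  by rewrite -p1E// -p2E//; ring.
exists (fun t => p1 t - p2 t); split => //.
have locq : locally_integrable setT (fun t => p1 t - p2 t).
  by apply: open_integrable_locally => //; exact: openT.
have := @FTC1 K _ (BRight 0) (fun y => ip 0 y _ iq) locq.
apply: filterS; first exact: (ae_filter_ringOfSetsType mu).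
move=> x + /andP[x0 xa] => /(_ x0).
set F := fun y => _; move=> [dF F'].
(* Near an interior point [f] is its value at 0 plus the integral [F], so the two have the same
   derivative there. *)
have near_f : {near x, (fun y => f 0 + F y) =1 f}.
  have : x \in `]0, a[ by rewrite in_itv/= x0.
  move=> /near_in_itvoo; apply: filterS => y; rewrite in_itv/= => /andP[y0 ya].
  by rewrite /F -qE// ?ltW//; ring.
have dFc : is_derive x 1 (fun y => f 0 + F y) (p1 x - p2 x).
  rewrite -[X in is_derive _ _ _ X]add0r -F' derive1E; apply: is_deriveD.
  exact: DeriveDef.
split.
  by apply: near_eq_derivable near_f _.
rewrite derive1E -(near_eq_derive _ near_f); exact: derive_val.
Qed.

(** The density of [abs_cont_density] depends on the right end of the segment, the derivative does
    not. For differentiability, the exceptional null sets of the segments ending at [n.+1%:R] are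
    united. *)
Lemma abs_cont_FTC f : (forall a, 0 < a -> abs_cont 0 a f) ->
    mu.-integrable `]0, +oo[ (EFin \o derive1 f) ->
  {ae mu, forall x, 0 < x -> derivable f x 1} /\
  forall x y, 0 <= x -> x <= y -> f y - f x = \int[mu]_(t in `]x, y]) derive1 f t.
Proof.
move=> ac if'; split.
  have H n := abs_cont_density (ltr0Sn K n) (ac _ (ltr0Sn K n)).
  have {}H n : {ae mu, forall x, 0 < x < n.+1%:R -> derivable f x 1}.
    have [q [_ _]] := H n; apply: filterS.
      exact: (ae_filter_ringOfSetsType mu).
    by move=> x h /h[].
  have := @ae_foralln _ _ _ mu _ H.
  apply: filterS.
  by move=> x h x0; apply: (h (Num.truncn x)); rewrite x0/= truncnS_gt.
(* The density formula holds strictly below the right end, so the segment is taken up to [y + 1]. *)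
move=> x y x0 xy; have y1 : 0 < y + 1 by rewrite ltr_wpDl// (le_trans x0).
have [q [iq qE qd]] := abs_cont_density y1 (ac _ y1).
rewrite qE// ?ltrDl//; congr fine; apply: ae_eq_integral => //.
- by apply: measurable_funS (measurable_int mu iq).
- apply: measurable_funS (measurable_int mu if') => //.
  by apply: subset_itv; rewrite bnd_simp.
apply: filterS qd; first exact: (ae_filter_ringOfSetsType mu).
move=> t /= h; rewrite in_itv/= => /andP[xt ty]; have [|_ ->//] := h.
by rewrite (le_lt_trans x0 xt) (le_lt_trans ty)// ltrDl.
Qed.

End fundamental_theorem.

(** * Integration on the real line *)

Section integral_toolbox.
Context {K : realType}.
Notation mu := (@lebesgue_measure K).
Implicit Types (A : set K) (f g h : K -> K).

Lemma integrable_mul_le1 A f h : measurable A ->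
  mu.-integrable A (EFin \o f) -> measurable_fun setT h ->
  (forall x, `|h x| <= 1) -> mu.-integrable A (EFin \o (fun x => f x * h x)).
Proof.
move=> mA intf mh h1.
have /measurable_EFinP mf := measurable_int mu intf.
apply: le_integrable intf => //.
  by apply/measurable_EFinP/measurable_funM => //; exact: measurable_funTS.
by move=> x Ax; rewrite lee_fin normrM ler_piMr.
Qed.

Lemma integrable_EFinD A f g : measurable A ->
  mu.-integrable A (EFin \o f) -> mu.-integrable A (EFin \o g) ->
  mu.-integrable A (EFin \o (fun x => f x + g x)).
Proof. by move=> mA intf intg; rewrite /comp; under eq_fun do rewrite EFinD;
  exact: integrableD. Qed.

Lemma integrable_EFinB A f g : measurable A ->
  mu.-integrable A (EFin \o f) -> mu.-integrable A (EFin \o g) ->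
  mu.-integrable A (EFin \o (fun x => f x - g x)).
Proof. by move=> mA intf intg; rewrite /comp; under eq_fun do rewrite EFinB;
  exact: integrableB. Qed.

Lemma integrable_EFinZ A f (c : K) : measurable A ->
  mu.-integrable A (EFin \o f) -> mu.-integrable A (EFin \o (fun x => c * f x)).
Proof. by move=> mA intf; rewrite /comp; under eq_fun do rewrite EFinM;
  exact: integrableZl. Qed.

Lemma measurable_sin_scale (t : K) : measurable_fun setT (fun u : K => sin (u * t)).
Proof.
apply: continuous_measurable_fun => u; apply: continuous_comp; last exact: continuous_sin.
exact: mulrr_continuous.
Qed.

Lemma measurable_cos_scale (t : K) : measurable_fun setT (fun u : K => cos (u * t)).
Proof.
apply: continuous_measurable_fun => u; apply: continuous_comp; last exact: continuous_cos.
exact: mulrr_continuous.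
Qed.

Lemma integrable_mul_sin A f (t : K) : measurable A ->
  mu.-integrable A (EFin \o f) ->
  mu.-integrable A (EFin \o (fun u => f u * sin (u * t))).
Proof.
move=> mA intf; apply: integrable_mul_le1 => //; first exact: measurable_sin_scale.
by move=> x; exact: sin_max.
Qed.

Lemma integrable_mul_cos A f (t : K) : measurable A ->
  mu.-integrable A (EFin \o f) ->
  mu.-integrable A (EFin \o (fun u => f u * cos (u * t))).
Proof.
move=> mA intf; apply: integrable_mul_le1 => //; first exact: measurable_cos_scale.
by move=> x; exact: cos_max.
Qed.

Lemma sine_transform_continuous A f : measurable A ->
  mu.-integrable A (EFin \o f) ->
  continuous (fun t => \int[mu]_(u in A) (f u * sin (u * t))).
Proof.
move=> mA intf t.
have := @continuity_under_integral K _ _ mu (fun t u => f u * sin (u * t)) A mA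
  (t - 1) (t + 1) (fun t _ => integrable_mul_sin t mA intf) _ (fun u => `|f u|) _ _.
apply => //.
- apply: aeW => u Au s _; apply: cvgM; first exact: cvg_cst.
  apply: continuous_comp; last exact: continuous_sin.
  exact: mulrl_continuous.
- exact: integrable_norm.
- by move=> s _; apply: aeW => u Au; rewrite normrM ler_piMr// sin_max.
- by rewrite inE/= in_itv/= ltrBlDr ltrDl ltr01.
Qed.

(** The bound on [h] leaves [|f t| * |g u|] as a majorant, whose iterated integral factors. *)
Lemma Fubini_tensor f g (h : K * K -> K) :
  mu.-integrable setT (EFin \o f) -> mu.-integrable setT (EFin \o g) ->
  measurable_fun setT h -> (forall z, `|h z| <= 1) ->
  \int[mu]_t (f t * \int[mu]_u (g u * h (t, u))) =
  \int[mu]_u (g u * \int[mu]_t (f t * h (t, u))).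
Proof.
move=> intf intg mh h1.
have /measurable_EFinP mf := measurable_int mu intf.
have /measurable_EFinP mg := measurable_int mu intg.
have mh1 t : measurable_fun setT (fun u => h (t, u)).
  by apply: (measurableT_comp mh); exact: measurable_pair1.
have mh2 u : measurable_fun setT (fun t => h (t, u)).
  by apply: (measurableT_comp mh); exact: measurable_pair2.
pose F (z : K * K) := (f z.1 * g z.2 * h z)%:E.
have mF : measurable_fun setT F.
  apply/measurable_EFinP; apply: measurable_funM => //; apply: measurable_funM.
    by apply: (measurableT_comp mf); exact: measurable_fst.
  by apply: (measurableT_comp mg); exact: measurable_snd.
have iF : (mu \x mu)%E.-integrable setT F.
  apply/integrable12ltyP => //.
  apply: (@le_lt_trans _ _ (\int[mu]_t (`|f t|%:E * \int[mu]_u `|g u|%:E))%E).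
    apply: ge0_le_integral => //.
    - by move=> t _; exact: integral_ge0.
    - have maF : measurable_fun setT (abse \o F) by exact: measurableT_comp.
      exact: (@measurable_fun_fubini_tonelli_F _ _ _ _ _ mu _ maF (fun=> abse_ge0 _)).
    - apply: emeasurable_funM; last exact: measurable_cst.
      by apply/measurable_EFinP; exact: measurableT_comp.
    move=> t _; rewrite -ge0_integralZl//; first last.
    - exact/measurable_EFinP/measurableT_comp.
    apply: ge0_le_integral => //.
    - apply: measurableT_comp => //; apply/measurable_EFinP => /=.
      apply: (measurable_funM _ (mh1 t)).
      by apply: measurable_funM => //; exact: measurable_cst.
    - apply/measurable_EFinP/measurable_funM => //; exact: measurableT_comp.
    - by move=> u _; rewrite /F/= -EFinM lee_fin !normrM ler_piMr// mulr_ge0.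
  have [_ fy] := integrableP _ _ _ intf; have [_ gy] := integrableP _ _ _ intg.
  rewrite ge0_integralZr//; last 2 first.
  - exact/measurable_EFinP/measurableT_comp.
  - exact: integral_ge0.
  by rewrite lte_mul_pinfty// ?integral_ge0// ge0_fin_numE ?integral_ge0.
have E1 t : (\int[mu]_u F (t, u) = (f t * \int[mu]_u (g u * h (t, u)))%:E)%E.
  rewrite EFinM /Rintegral fineK; last first.
    by apply: integrable_fin_num => //; exact: integrable_mul_le1.
  rewrite -integralZl//; last exact: integrable_mul_le1.
  by apply: eq_integral => u _; rewrite /F/= -EFinM mulrA.
have E2 u : (\int[mu]_t F (t, u) = (g u * \int[mu]_t (f t * h (t, u)))%:E)%E.
  rewrite EFinM /Rintegral fineK; last first.
    by apply: integrable_fin_num => //; exact: integrable_mul_le1.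
  rewrite -integralZl//; last exact: integrable_mul_le1.
  by apply: eq_integral => t _; rewrite /F/= -EFinM mulrCA mulrA.
rewrite {1}/Rintegral [in RHS]/Rintegral; congr fine.
under eq_integral do rewrite -E1.
under [in RHS]eq_integral do rewrite -E2.
exact: Fubini.
Qed.

End integral_toolbox.

(** * Changes of variable that preserve Lebesgue measure *)

Section measure_preserving.
Context {K : realType}.
Notation mu := (@lebesgue_measure K).

Section measure_preserving_map.
Variable T : K -> K.
Hypothesis mT : measurable_fun setT T.
Hypothesis muT : forall a b, a <= b -> mu (T @^-1` `]a, b]) = (b - a)%:E.

Let nu : {measure set (measurableTypeR K) -> \bar K} :=
  @measure_function_pushforward__canonical__measure_function_Measure _ _
    (measurableTypeR K) (measurableTypeR K) _ mu T mT.

(** Lebesgue measure is determined by its values on half-open intervals, and those are what [muT]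
    prescribes. *)
Let nuE (A : set K) : measurable A -> nu A = mu A.
Proof.
move=> mA; apply/esym/lebesgue_measure_unique => // _ [[a b] _ <-].
rewrite /= /pushforward; have [ab|ba] := leP a b.
  by rewrite [RHS]muT// lebesgue_measure_itv/= lte_fin; case: ltP => // ba;
    rewrite (@le_anti _ _ a b) ?ab// subrr.
by rewrite set_itv_ge ?bnd_simp -?leNgt ?(ltW ba)// preimage_set0 !measure0.
Qed.

Lemma ge0_integral_measure_preserving (f : K -> K) : measurable_fun setT f ->
  (forall x, 0 <= f x) ->
  (\int[mu]_x (f (T x))%:E = \int[mu]_x (f x)%:E)%E.
Proof.
move=> mf f0; rewrite [RHS](eq_measure_integral nu); last by move=> A mA _;
  rewrite [RHS]nuE.
rewrite ge0_integral_pushforward//; first exact/measurable_EFinP.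
by move=> x _; rewrite lee_fin.
Qed.

Lemma integrable_measure_preserving (f : K -> K) :
  mu.-integrable setT (EFin \o f) -> mu.-integrable setT (EFin \o (f \o T)).
Proof.
move=> /integrableP[/measurable_EFinP mf fy]; apply/integrableP; split.
  by apply/measurable_EFinP; exact: measurableT_comp.
rewrite (_ : (\int[mu]_x `|(EFin \o (f \o T)) x| = \int[mu]_x (`|f (T x)|)%:E)%E)//.
rewrite (@ge0_integral_measure_preserving (fun x => `|f x|))//.
exact: measurableT_comp.
Qed.

Lemma Rintegral_measure_preserving (f : K -> K) :
  mu.-integrable setT (EFin \o f) ->
  \int[mu]_x f (T x) = \int[mu]_x f x.
Proof.
move=> intf; rewrite /Rintegral; congr fine.
rewrite [RHS](eq_measure_integral nu); last by move=> A mA _; rewrite [RHS]nuE.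
rewrite integral_pushforward//; first exact: (measurable_int mu intf).
exact: integrable_measure_preserving.
Qed.

End measure_preserving_map.

Lemma lebesgue_measure_shift (c a b : K) : a <= b ->
  mu ((fun x => x + c) @^-1` `]a, b]) = (b - a)%:E.
Proof.
move=> ab; rewrite [X in mu X](_ : _ = `]a - c, b - c]%classic); last first.
  by apply/seteqP; split => x /=; rewrite !in_itv/= ltrBlDr lerBrDr.
rewrite lebesgue_measure_itv/= lte_fin ltrD2r; case: ltP => ba.
  by rewrite -EFinD; congr EFin; ring.
by rewrite (@le_anti _ _ a b) ?ab// subrr.
Qed.

Lemma lebesgue_measure_opp (a b : K) : a <= b ->
  mu (-%R @^-1` `]a, b]) = (b - a)%:E.
Proof.
move=> ab; rewrite [X in mu X](_ : _ = `[- b, - a[%classic); last first.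
  by apply/seteqP; split => x /=; rewrite !in_itv/= ltrNr lerNl andbC.
rewrite lebesgue_measure_itv/= lte_fin ltrN2; case: ltP => ba.
  by rewrite -EFinD; congr EFin; ring.
by rewrite (@le_anti _ _ a b) ?ab// subrr.
Qed.

Lemma measurable_shift (c : K) : measurable_fun setT (fun x : K => x + c).
Proof. by apply: measurable_funD => //; exact: measurable_cst. Qed.

End measure_preserving.

(** * Inversion of the sine transform *)

Section abel_kernel.
Context {K : realType}.
Notation mu := (@lebesgue_measure K).
Local Notation A := (`]0, +oo[%classic : set K).

Lemma cvg_expRM_y (a : K) : 0 < a -> expR (- (a * t)) @[t --> +oo] --> 0.
Proof.
move=> a0; apply: (@cvg_comp _ _ _ (fun t => a * t) (fun s =>
  expR (- s)) _ (pinfty_nbhs K)); last exact: cvgr_expR.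
exact: gt0_cvgMry a0 (@cvg_id _ _).
Qed.

(** An antiderivative vanishing at infinity: the first term is the real part of
    [exp((- a + i v) t) / (- a + i v)], which accounts for the cosine. *)
Let P (a v t : K) : K := expR (- (a * t)) * (v * sin (t * v) - a * cos (t * v))
  / (a ^+ 2 + v ^+ 2)
  - expR (- (a * t)) / a.

Let dP (a v t : K) : 0 < a ->
  is_derive t 1 (P a v) (expR (- (a * t)) * (1 + cos (t * v))).
Proof.
move=> a0; have av : a ^+ 2 + v ^+ 2 != 0.
  by rewrite gt_eqF// ltr_pwDl ?exprn_gt0// sqr_ge0.
have an0 : a != 0 by rewrite gt_eqF.
rewrite /P; apply: is_derive_eq.
rewrite /GRing.scale/= !(mulr1, mulr0, mul0r, mul1r, add0r, addr0, subr0).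
by field; rewrite av an0.
Qed.

Lemma expR_1Dcos_ge0 (x y : K) : 0 <= expR x * (1 + cos y).
Proof. by apply: mulr_ge0; [exact: expR_ge0|have := cos_geN1 y; lra]. Qed.

(* [1 + cos] in place of [cos] keeps the integrand nonnegative, as the
   fundamental theorem on a half-line requires. *)
Lemma integral_expR_1Dcos (a v : K) : 0 < a ->
  (\int[mu]_(t in `[0%R, +oo[) (expR (- (a * t)) * (1 + cos (t * v)))%:E =
   (a^-1 + a / (a ^+ 2 + v ^+ 2))%:E)%E.
Proof.
move=> a0; rewrite (@ge0_continuous_FTC2y _ _ (P a v) 0 0).
- rewrite /P !mulr0 oppr0 expR0 mul0r sin0 cos0 mulr0 !mul1r mulr1 sub0r.
  by rewrite -EFinB; congr EFin; ring.
- by move=> t _; exact: expR_1Dcos_ge0.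
- apply: continuous_subspaceT => t; apply: cvgM.
    apply: continuous_comp; last exact: continuous_expR.
    by apply: continuousN; exact: mulrl_continuous.
  apply: cvgD; first exact: cvg_cst.
  apply: continuous_comp; last exact: continuous_cos.
  exact: mulrr_continuous.
- have e0 := cvg_expRM_y a0.
  (* [C] is chosen so that [|P a v t| <= C * expR (- (a * t))]. *)
  pose C := (`|v| + a) / (a ^+ 2 + v ^+ 2) + a^-1.
  have C0 : 0 < C.
    by rewrite ltr_wpDl ?invr_gt0// divr_ge0// addr_ge0 ?sqr_ge0// ltW.
  apply/cvgr0Pnorm_lt => e e1.
  have eC : 0 < e / C by rewrite divr_gt0.
  move/cvgr0Pnorm_lt/(_ _ eC) : e0; apply: filterS => t.
  rewrite ger0_norm ?expR_ge0// ltr_pdivlMr//; apply: le_lt_trans.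
  rewrite /P -mulrA -mulrBr normrM ger0_norm ?expR_ge0// ler_wpM2l ?expR_ge0//.
  apply: le_trans (ler_normB _ _) _; rewrite /C lerD//; last first.
    by rewrite ger0_norm ?invr_ge0// ltW.
  rewrite normrM (@ger0_norm _ (_^-1)) ?invr_ge0 ?addr_ge0 ?sqr_ge0//.
  rewrite ler_wpM2r ?invr_ge0 ?addr_ge0 ?sqr_ge0//.
  apply: le_trans (ler_normB _ _) _; rewrite lerD// normrM.
    by rewrite ler_piMr// sin_max.
  by rewrite (gtr0_norm a0) ler_piMr ?cos_max// ltW.
- by move=> t _; have [] := dP v t a0.
- have [] := dP v 0 a0 => /derivable1_diffP/differentiable_continuous h _.
  by apply: cvg_within_filter; exact: h.
- by move=> t _; rewrite derive1E; have [_ ->] := dP v t a0.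
Qed.

Lemma integrable_expR_1Dcos (a v : K) : 0 < a ->
  mu.-integrable A (EFin \o (fun t => expR (- (a * t)) * (1 + cos (t * v)))).
Proof.
move=> a0.
have cont : continuous (fun t : K => expR (- (a * t)) * (1 + cos (t * v))).
  move=> t; apply: cvgM.
    apply: continuous_comp; last exact: continuous_expR.
    by apply: continuousN; exact: mulrl_continuous.
  apply: cvgD; first exact: cvg_cst.
  apply: continuous_comp; last exact: continuous_cos.
  exact: mulrr_continuous.
apply/integrableP; split.
  by apply/measurable_EFinP/measurable_funTS; exact: continuous_measurable_fun.
under eq_integral => t _.
  rewrite /= ger0_norm; last exact: expR_1Dcos_ge0.
  over.
rewrite integral_itv_obnd_cbnd; last first.
  by apply/measurable_EFinP/measurable_funTS; exact: continuous_measurable_fun.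
by rewrite integral_expR_1Dcos// ltry.
Qed.

(** For [v = 0] the factor [1 + cos] is the constant 2. *)
Lemma integrable_expR (a : K) : 0 < a ->
  mu.-integrable A (EFin \o (fun t => expR (- (a * t)))).
Proof.
move=> a0; have := integrable_expR_1Dcos 0 a0.
move=> /(@integrableZl _ _ _ mu _ _ (2^-1)) => /(_ (measurable_itv _)).
rewrite /comp/=; congr (mu.-integrable _ _); apply/funext => t /=.
by rewrite mulr0 cos0 -EFinM; congr EFin; field.
Qed.

Lemma Rintegral_expR_1Dcos (a v : K) : 0 < a ->
  \int[mu]_(t in A) (expR (- (a * t)) * (1 + cos (t * v))) =
   a^-1 + a / (a ^+ 2 + v ^+ 2).
Proof.
move=> a0; rewrite Rintegral_itv_obnd_cbnd; last exact: integrable_expR_1Dcos.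
by rewrite /Rintegral integral_expR_1Dcos.
Qed.

Lemma Rintegral_expR (a : K) : 0 < a -> \int[mu]_(t in A) expR (- (a * t)) = a^-1.
Proof.
move=> a0; have := Rintegral_expR_1Dcos 0 a0.
rewrite expr0n/= addr0.
rewrite [LHS](_ : _ = 2 * \int[mu]_(t in A) expR (- (a * t))).
  move=> h; have {h} : \int[mu]_(t in A) expR (- (a * t)) = (a^-1 + a / a ^+ 2) / 2.
    by rewrite -h mulrC mulKf// pnatr_eq0.
  by move=> ->; field; rewrite gt_eqF.
rewrite -RintegralZl//; last exact: integrable_expR.
by apply: eq_Rintegral => t _; rewrite mulr0 cos0; ring.
Qed.

Lemma Rintegral_expR_cos (a v : K) : 0 < a ->
  \int[mu]_(t in A) (expR (- (a * t)) * cos (t * v)) = a / (a ^+ 2 + v ^+ 2).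
Proof.
move=> a0; have := Rintegral_expR_1Dcos v a0.
under eq_Rintegral do rewrite mulrDr mulr1.
rewrite RintegralD//; [|exact: integrable_expR|by apply:
  integrable_mul_cos => //; exact: integrable_expR].
by rewrite Rintegral_expR// => /addrI.
Qed.

Definition abel_weight (e M t : K) := expR (- (e * t)) - expR (- (M * t)).

(* The second exponential of the weight makes the kernel bounded near [0],
   hence integrable on the whole half-line. *)
Definition abel_kernel (e M t : K) := abel_weight e M t / t.

Lemma abel_weight_ge0 e M t : e <= M -> 0 <= t -> 0 <= abel_weight e M t.
Proof. by move=> eM t0; rewrite subr_ge0 ler_expR lerN2 ler_wpM2r. Qed.

Lemma abel_weight_le1 e M t : 0 <= e -> e <= M -> 0 <= t -> `|abel_weight e M t| <= 1.
Proof.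
move=> e0 eM t0; rewrite ger0_norm ?abel_weight_ge0// lerBlDr.
by rewrite (@le_trans _ _ 1)// ?lerDl ?expR_ge0// expR_le1 oppr_le0 mulr_ge0.
Qed.

(** The weight is [expR (- (e * t)) * (1 - expR (- ((M - e) * t)))], and [1 + x <= expR x] bounds
    the second factor by [(M - e) * t], which absorbs the denominator. *)
Lemma abel_kernel_ub e M t : e <= M -> 0 < t ->
  `|abel_kernel e M t| <= (M - e) * expR (- (e * t)).
Proof.
move=> eM t0; rewrite ger0_norm ?divr_ge0 ?abel_weight_ge0 ?(ltW t0)//.
rewrite ler_pdivrMr// /abel_weight.
have -> : expR (- (M * t)) = expR (- (e * t)) * expR (- ((M - e) * t)).
  by rewrite -expRD; congr expR; ring.
rewrite -{1}[expR _]mulr1 -mulrBr -mulrAC mulrC ler_wpM2r ?expR_ge0//.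
by rewrite lerBlDl -lerBlDr; apply: le_trans (expR_ge1Dx _); lra.
Qed.

Lemma abel_weight_continuous e M : continuous (abel_weight e M).
Proof.
move=> t; apply: cvgB.
  apply: continuous_comp; last exact: continuous_expR.
  by apply: continuousN; exact: mulrl_continuous.
apply: continuous_comp; last exact: continuous_expR.
by apply: continuousN; exact: mulrl_continuous.
Qed.

Lemma integrable_abel_weight e M : 0 < e -> e <= M ->
  mu.-integrable A (EFin \o abel_weight e M).
Proof.
move=> e0 eM.
have -> : EFin \o abel_weight e M =
  (fun t => (expR (- (e * t)))%:E - (expR (- (M * t)))%:E)%E by apply/funext.
by apply: integrableB => //; apply: integrable_expR => //; exact: lt_le_trans eM.
Qed.

Lemma measurable_abel_kernel e M : measurable_fun A (abel_kernel e M).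
Proof.
apply: measurable_funM; first by apply: measurable_funTS;
  apply: continuous_measurable_fun; exact: abel_weight_continuous.
apply: open_continuous_measurable_fun; first exact: interval_open.
move=> t; rewrite inE/= in_itv/= andbT => t0.
by apply: cvgV; [rewrite gt_eqF|exact: cvg_id].
Qed.

Lemma integrable_abel_kernel e M : 0 < e -> e <= M ->
  mu.-integrable A (EFin \o abel_kernel e M).
Proof.
move=> e0 eM.
have := @integrableZl _ _ _ mu _ (measurable_itv _) (M - e) _ (integrable_expR e0).
apply: le_integrable => //; first by apply/measurable_EFinP;
  exact: measurable_abel_kernel.
move=> t; rewrite /= in_itv/= andbT => t0; rewrite lee_fin.
apply: le_trans (abel_kernel_ub eM t0) _; exact: ler_norm.
Qed.

(** Differentiation in [v] brings down a factor [t] that cancels the denominator of the kernel. The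
    resulting integrand is dominated by the integrable weight, and its integral is a difference of
    two instances of [Rintegral_expR_cos]. *)
Lemma is_derive_abel_sine e M (v : K) : 0 < e -> e <= M ->
  is_derive v 1 (fun v => \int[mu]_(t in A) (abel_kernel e M t * sin (t * v)))
    (e / (e ^+ 2 + v ^+ 2) - M / (M ^+ 2 + v ^+ 2)).
Proof.
move=> e0 eM; have M0 : 0 < M by exact: lt_le_trans eM.
have dk (x t : K) : is_derive x 1 (fun x => abel_kernel e M t * sin (t * x))
    (abel_kernel e M t * (t * cos (t * x))).
  by apply: is_derive_eq; rewrite /GRing.scale/= mulr1; congr (_ * _); exact: mulrC.
have d1 (x t : K) : partial1of2 (fun x t => abel_kernel e M t * sin (t * x)) x t =
    abel_kernel e M t * (t * cos (t * x)).
  by rewrite partial1of2E; exact: derive_val.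
have int1 (x : K) : `]v - 1, v + 1[%classic x ->
    mu.-integrable A (EFin \o (fun t => abel_kernel e M t * sin (t * x))).
  by move=> _; apply: integrable_mul_sin => //; exact: integrable_abel_kernel.
have der1 (x t : K) : `]v - 1, v + 1[%classic x -> A t ->
    derivable (fun x => abel_kernel e M t * sin (t * x)) x 1.
  by move=> _ _; have [] := dk x t.
have Iv : `]v - 1, v + 1[%classic v by rewrite /= in_itv/= ltrBlDr ltrDl ltr01.
have ub (x t : K) : `]v - 1, v + 1[%classic x -> A t ->
    `|partial1of2 (fun x t => abel_kernel e M t * sin (t * x)) x t| <=
      `|abel_weight e M t|.
  rewrite d1 /= !in_itv/= andbT => _ t0.
  by rewrite mulrA /abel_kernel divfK ?gt_eqF// normrM ler_piMr// cos_max.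
have iG : mu.-integrable A (EFin \o (fun t => `|abel_weight e M t|)).
  by apply: integrable_norm; exact: integrable_abel_weight.
have G0 t : 0 <= `|abel_weight e M t| by [].
have mA : measurable A by exact: measurable_itv.
have D := @derivable_under_integral K _ _ mu _ A mA v (v - 1) (v + 1) Iv int1
  der1 _ G0 iG ub.
have E := @differentiation_under_integral K _ _ mu _ A mA v (v - 1) (v + 1) Iv
  int1 der1 _ G0 iG ub.
apply: DeriveDef; first exact: D.
rewrite -derive1E E -!Rintegral_expR_cos// -RintegralB//.
- apply: eq_Rintegral => t; rewrite inE/= in_itv/= andbT => t0.
  by rewrite d1 mulrA /abel_kernel divfK ?gt_eqF// mulrBl.
- by apply: integrable_mul_cos => //; exact: integrable_expR.
- by apply: integrable_mul_cos => //; exact: integrable_expR.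
Qed.

(** Both sides vanish at [v = 0] and have the same derivative. *)
Lemma abel_sine e M (v : K) : 0 < e -> e <= M ->
  \int[mu]_(t in A) (abel_kernel e M t * sin (t * v)) = atan (v / e) - atan (v / M).
Proof.
move=> e0 eM; have M0 : 0 < M by exact: lt_le_trans eM.
pose S (v : K) := \int[mu]_(t in A) (abel_kernel e M t * sin (t * v)).
have datan (c x : K) : 0 < c -> is_derive x 1 (fun x =>
  atan (x / c)) (c / (c ^+ 2 + x ^+ 2)).
  move=> c0; apply: is_derive_eq; rewrite /GRing.scale/= mulr0 add0r mulr1.
  field; rewrite !gt_eqF//= ?ltr_pwDl ?exprn_gt0 ?sqr_ge0//.
have := @is_derive_0_is_cst K (fun v => S v - (atan (v / e) - atan (v / M))) v 0 _.
have S0 : S 0 = 0.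
  by rewrite /S; under eq_Rintegral do rewrite mulr0 sin0 mulr0;
    rewrite Rintegral_cst// mul0r.
rewrite S0 !mul0r atan0 !subr0 => h; apply/eqP; rewrite -subr_eq0; apply/eqP/h => x.
have := is_derive_abel_sine x e0 eM => d1.
have d2 := datan e x e0; have d3 := datan M x M0.
by apply: is_derive_eq; ring.
Qed.

End abel_kernel.

(** * Removal of the smoothing and the inversion formula *)

Section sine_inversion.
Context {K : realType}.
Notation mu := (@lebesgue_measure K).
Local Notation A := (`]0, +oo[%classic : set K).

Lemma Rintegral_dominated_cvg (B : set K) (f_ : nat -> K -> K) (f g : K -> K) :
  measurable B -> (forall n, measurable_fun B (f_ n)) -> measurable_fun B f ->
  (forall x, B x -> f_ n x @[n --> \oo] --> f x) ->
  mu.-integrable B (EFin \o g) -> (forall n x, B x -> `|f_ n x| <= g x) ->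
  \int[mu]_(x in B) f_ n x @[n --> \oo] --> \int[mu]_(x in B) f x.
Proof.
move=> mB mf_ mf cf ig ub.
have [||||| iff _ lim] := @dominated_convergence _ _ _ mu B mB
  (fun n => EFin \o f_ n) (EFin \o f) (EFin \o g).
- by move=> n; apply/measurable_EFinP; exact: mf_.
- by apply/measurable_EFinP.
- apply: aeW => x Bx; apply: cvg_EFin; first exact: nearW.
  exact: cf.
- exact: ig.
- by apply: aeW => x n Bx; rewrite lee_fin ub.
apply: fine_cvg; rewrite /Rintegral fineK; first exact: lim.
exact: integrable_fin_num.
Qed.

Lemma cvgy_natSS : (n.+2%:R : K) @[n --> \oo] --> +oo.
Proof.
apply/cvgryPge => r; near=> n; rewrite (@le_trans _ _ n%:R) ?ler_nat ?(leqW (leqnSn _))//.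
by near: n; exact: nbhs_infty_ger.
Unshelve. all: by end_near. Qed.

Lemma cvgy_scale (c : K) : 0 < c -> c * n.+2%:R @[n --> \oo] --> +oo.
Proof.
move=> c0; apply: (@cvg_comp _ _ _ (fun n => n.+2%:R) (fun s => c * s) _ (pinfty_nbhs K)).
  exact: cvgy_natSS.
exact: gt0_cvgMry c0 (@cvg_id _ _).
Qed.

(** The first argument is [v * n.+2%:R], which runs off to infinity on the side of [v]; the second
    tends to 0. At [v = 0] both terms vanish, in accordance with [Num.sg 0 = 0]. *)
Lemma cvg_atan_scale (v : K) :
  atan (v / n.+2%:R^-1) - atan (v / n.+2%:R) @[n --> \oo] --> pi / 2 * Num.sg v.
Proof.
have cN := cvgy_natSS.
have cV : (n.+2%:R^-1 : K) @[n --> \oo] --> 0.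
  by apply/gtr0_cvgV0 => //; near=> n.
rewrite -[X in _ --> X]subr0; apply: cvgB; last first.
  rewrite -(@atan0 K); apply: continuous_cvg; first exact: continuous_atan.
  by rewrite -[X in _ --> X](mulr0 v); apply: cvgMr.
under eq_fun do rewrite invrK.
have pos (w : K) : 0 < w -> atan (w * n.+2%:R) @[n --> \oo] --> pi / 2.
  move=> w0; apply: (@cvg_comp _ _ _ _ atan _ (pinfty_nbhs K)); last exact: cvgy_atan.
  exact: cvgy_scale.
have [v0|v0|->] := ltgtP v 0.
- rewrite ltr0_sg// mulrN1.
  have -> : (fun n => atan (v * n.+2%:R)) = (fun n => - atan (- v * n.+2%:R)).
    by apply/funext => n; rewrite mulNr atanN opprK.
  by apply: cvgN; apply: pos; rewrite oppr_gt0.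
- by rewrite gtr0_sg// mulr1; exact: pos.
- by rewrite sgr0 mulr0; under eq_fun do rewrite mul0r atan0; exact: cvg_cst.
Unshelve. all: by end_near. Qed.

Lemma norm_atanB_le (x y : K) : `|atan x - atan y| <= pi.
Proof.
rewrite ler_norml; have := atan_gtNpi2 x; have := atan_ltpi2 x.
by have := atan_gtNpi2 y; have := atan_ltpi2 y; lra.
Qed.

Variable D : K -> K.
Hypothesis iD : mu.-integrable setT (EFin \o D).
Hypothesis D0 : forall u, u <= 0 -> D u = 0.
Let G t := \int[mu]_u (D u * sin (u * t)).
Hypothesis iG : mu.-integrable A (EFin \o (fun t => G t / t)).

(** By [abel_sine], the sine transform of the kernel [k n] introduced below. *)
Let S n v : K := atan (v / n.+2%:R^-1) - atan (v / n.+2%:R).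

Let eM n : (n.+2%:R^-1 : K) <= n.+2%:R.
Proof. by rewrite (@le_trans _ _ 1)// ?invf_le1// ler1n. Qed.

Let w n := @abel_weight K n.+2%:R^-1 n.+2%:R.
Let k n := @abel_kernel K n.+2%:R^-1 n.+2%:R.

Let ik n : mu.-integrable A (EFin \o k n).
Proof. by apply: integrable_abel_kernel => //; rewrite invr_gt0. Qed.

(** [Fubini_tensor] applies to [k n], extended by zero, and [D]; the inner integral in [t] is then a
    half-sum of two instances of [abel_sine]. *)
Lemma sine_inversion_smoothed n (x : K) :
  \int[mu]_(t in A) (G t / t * cos (t * x) * w n t) =
  \int[mu]_u (D u * (2^-1 * (S n (u + x) + S n (u - x)))).
Proof.
pose h (z : K * K) := sin (z.2 * z.1) * cos (z.1 * x).
have mh : measurable_fun setT h.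
  apply: measurable_funM.
    apply: measurableT_comp; first exact: (continuous_measurable_fun (@continuous_sin K)).
    by apply: measurable_funM; [exact: measurable_snd|exact: measurable_fst].
  apply: measurableT_comp; first exact: (continuous_measurable_fun (@continuous_cos K)).
  by apply: measurable_funM; [exact: measurable_fst|exact: measurable_cst].
have h1 z : `|h z| <= 1.
  by rewrite /h normrM mulr_ile1// ?sin_max// cos_max.
have ikT : mu.-integrable setT (EFin \o (k n \_ A)).
  by rewrite -restrict_EFin; apply/(integrable_mkcond _ _).1.
have := Fubini_tensor ikT iD mh h1.
set X := (X in X = _ -> _); set Y := (Y in _ = Y -> _).
have -> : X = \int[mu]_(t in A) (G t / t * cos (t * x) * w n t).
  rewrite [RHS]Rintegral_mkcond; apply: eq_Rintegral => t _.
  rewrite !patchE; case: ifPn => tA; last by rewrite mul0r.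
  have -> : \int[mu]_u (D u * h (t, u)) = G t * cos (t * x).
    rewrite /G -RintegralZr//; last exact: integrable_mul_sin.
    by apply: eq_Rintegral => u _; rewrite /h/= mulrA.
  by rewrite /k /abel_kernel -/(w n t); ring.
move=> ->; apply: eq_Rintegral => u _; congr (_ * _).
have -> : \int[mu]_t ((k n \_ A) t * h (t, u)) =
    \int[mu]_(t in A) (2^-1 * (k n t * sin (t * (u + x)) + k n t * sin (t * (u - x)))).
  rewrite [RHS]Rintegral_mkcond; apply: eq_Rintegral => t _.
  rewrite !patchE; case: ifPn => tA; last by rewrite mul0r.
  by rewrite /h/= (mulrDr t u x) (mulrBr t u x) sinD sinB (mulrC u t); field.
rewrite RintegralZl//; last first.
  by apply: integrable_EFinD => //; exact: integrable_mul_sin.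
rewrite RintegralD//; [|exact: integrable_mul_sin|exact: integrable_mul_sin].
by rewrite !abel_sine// ?invr_gt0.
Qed.

(** Both sides of [sine_inversion_smoothed] converge by dominated convergence: the weight is at most
    1, which gives the majorant [|G t / t|], and a difference of arctangents is at most [pi], which
    gives [|D u| * pi]. *)
Lemma sine_inversion (x : K) : 0 <= x ->
  \int[mu]_(t in A) (G t / t * cos (t * x)) =
  pi / 2 * \int[mu]_(u in `]x, +oo[) D u.
Proof.
move=> x0.
have mA : measurable A by exact: measurable_itv.
have /measurable_EFinP mG := measurable_int mu iG.
have /measurable_EFinP mD := measurable_int mu iD.
have mGc : measurable_fun A (fun t => G t / t * cos (t * x)).
  by apply: measurable_funM => //; apply: measurable_funTS; exact: measurable_cos_scale.
have mS n : continuous (S n).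
  move=> v; apply: cvgB; apply: (@continuous_comp _ _ _ (fun v : K => v / _) atan);
    solve [exact: mulrr_continuous|exact: continuous_atan].
have L1 : \int[mu]_(t in A) (G t / t * cos (t * x) * w n t) @[n --> \oo] -->
    \int[mu]_(t in A) (G t / t * cos (t * x)).
  apply: (@Rintegral_dominated_cvg _ _ _ (fun t => `|G t / t|)) => //.
  - move=> n; apply: measurable_funM => //.
    apply: measurable_funTS; apply: continuous_measurable_fun;
      exact: abel_weight_continuous.
  - move=> t; rewrite /= in_itv/= andbT => t0.
    rewrite -[X in _ --> X]mulr1; apply: cvgMr.
    have cN := cvgy_natSS.
    rewrite -[X in _ --> X]subr0; apply: cvgB.
      rewrite [X in _ --> X](_ : _ = expR (- (0 * t))); last by rewrite mul0r oppr0 expR0.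
      apply: continuous_cvg; first exact: continuous_expR.
      apply: cvgN; apply: cvgMl.
      by apply/gtr0_cvgV0 => //; near=> n.
    apply: (@cvg_comp _ _ _ _ (fun s => expR (- s)) _ (pinfty_nbhs K));
      last exact: cvgr_expR.
    by under eq_fun do rewrite mulrC; exact: cvgy_scale.
  - exact: integrable_norm.
  - move=> n t; rewrite /= in_itv/= andbT => t0.
    rewrite normrM (@le_trans _ _ `|G t / t * cos (t * x)|)//.
      by rewrite ler_piMr// abel_weight_le1 ?invr_ge0 ?(ltW t0).
    by rewrite normrM ler_piMr// cos_max.
pose H u := D u * (2^-1 * (pi / 2 * Num.sg (u + x) + pi / 2 * Num.sg (u - x))).
have msg (c : K) : measurable_fun setT (fun u : K => Num.sg (u + c)).
  apply: nondecreasing_measurable => // u v uv.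
  by case: (sgrP (u + c)) => h1; case: (sgrP (v + c)) => h2; move: uv h1 h2; lra.
have mH : measurable_fun setT H.
  apply: measurable_funM => //; apply: measurable_funM; first exact: measurable_cst.
  by apply: measurable_funD; apply: measurable_funM => //; exact: measurable_cst.
have cs (c : K) : continuous (fun u : K => u + c).
  by move=> u; apply: cvgD; [exact: cvg_id|exact: cvg_cst].
have L2 : \int[mu]_u (D u * (2^-1 * (S n (u + x) + S n (u - x)))) @[n --> \oo] -->
    \int[mu]_u H u.
  apply: (@Rintegral_dominated_cvg _ _ _ (fun u => `|D u| * pi)) => //.
  - move=> n; apply: measurable_funM => //; apply: measurable_funM;
      first exact: measurable_cst.
    apply: measurable_funD; apply: continuous_measurable_fun => u.
      by apply: (@continuous_comp _ _ _ (fun u => u + x) (S n)); [exact: cs|exact: mS].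
    by apply: (@continuous_comp _ _ _ (fun u => u - x) (S n)); [exact: cs|exact: mS].
  - move=> u _; apply: cvgMr; apply: cvgMr; apply: cvgD; exact: cvg_atan_scale.
  - under eq_fun do rewrite mulrC.
    by apply: integrable_EFinZ => //; exact: integrable_norm.
  - move=> n u _; rewrite normrM ler_wpM2l// normrM gtr0_norm ?invr_gt0//.
    have := norm_atanB_le ((u + x) / n.+2%:R^-1) ((u + x) / n.+2%:R).
    have := norm_atanB_le ((u - x) / n.+2%:R^-1) ((u - x) / n.+2%:R).
    rewrite -/(S n (u + x)) -/(S n (u - x)).
    have := ler_normD (S n (u + x)) (S n (u - x)); lra.
have E : \int[mu]_(t in A) (G t / t * cos (t * x)) = \int[mu]_u H u.
  move: L1; under eq_fun do rewrite sine_inversion_smoothed.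
  by move=> L1; apply: (cvg_unique _ L1 L2).
rewrite E.
have iDx : mu.-integrable `]x, +oo[ (EFin \o D) by exact: integrableS iD.
(* For [0 < u < x] the two signs are opposite, and [D] vanishes for [u <= 0]. *)
have -> : \int[mu]_u H u = \int[mu]_(u in `[x, +oo[) H u.
  rewrite [RHS]Rintegral_mkcond; apply: eq_Rintegral => u _.
  rewrite patchE; case: ifPn => //; rewrite notin_setE/= in_itv/= andbT => /negP.
  rewrite -ltNge => ux; rewrite /H.
  have [u0|u0] := leP u 0; first by rewrite D0// mul0r.
  rewrite gtr0_sg ?ltr_wpDr// ltr0_sg ?subr_lt0//.
  by rewrite mulrN1 mulr1 subrr !mulr0.
have HD u : `]x, +oo[%classic u -> H u = pi / 2 * D u.
  rewrite /= in_itv/= andbT => xu.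
  rewrite /H gtr0_sg ?ltr_wpDr ?(le_lt_trans x0 xu)// gtr0_sg ?subr_gt0//.
  by field.
(* At [u = x] the second sign is 0 and the formula of [HD] may fail; the endpoint is dropped as a
   null set. *)
rewrite -Rintegral_itv_obnd_cbnd; last first.
  have : mu.-integrable `]x, +oo[ (EFin \o (fun u => pi / 2 * D u)).
    exact: integrable_EFinZ.
  by apply: eq_integrable => // u; rewrite inE => /HD /= ->.
rewrite -RintegralZl//; apply: eq_Rintegral => u; rewrite inE; exact: HD.
Unshelve. all: by end_near. Qed.

End sine_inversion.

(** * Sine transforms of monotone functions *)

Section monotone_sine_transform.
Context {K : realType}.
Notation mu := (@lebesgue_measure K).

Lemma norm_sin_le (x : K) : 0 <= x -> `|sin x| <= x.
Proof.
move=> x0; have [|c _] := @MVT_segment K sin cos 0 x x0.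
  by apply: continuous_subspaceT; exact: continuous_sin.
rewrite sin0 !subr0 => ->; rewrite normrM (ger0_norm x0) ler_piMl//.
exact: cos_max.
Qed.

Lemma integrable_setU_disj (A B : set K) (f : K -> K) : measurable A -> measurable B ->
  [disjoint A & B] -> mu.-integrable A (EFin \o f) -> mu.-integrable B (EFin \o f) ->
  mu.-integrable (A `|` B) (EFin \o f).
Proof.
move=> mA mB AB /integrableP[mfA fA] /integrableP[mfB fB].
have mf : measurable_fun (A `|` B) (EFin \o f) by apply/measurable_funU.
apply/integrableP; split => //.
rewrite ge0_integral_setU//; last exact: measurableT_comp.
exact: lte_add_pinfty.
Qed.

Lemma integral_indic_itv (x y : K) : x <= y ->
  (\int[mu]_u (\1_(`]x, y]%classic) u)%:E = (y - x)%:E)%E.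
Proof.
move=> xy.
have -> : (\int[mu]_u (\1_(`]x, y]%classic) u)%:E = mu `]x, y]%classic)%E.
  by rewrite integral_indic// setIT.
rewrite lebesgue_measure_itv/= lte_fin -EFinB.
by case: ltP => // yx; rewrite (@le_anti _ _ x y) ?xy// subrr.
Qed.

Lemma integrable_indic_itv (x y : K) : x <= y ->
  mu.-integrable setT (EFin \o \1_(`]x, y]%classic)).
Proof.
move=> xy; apply/integrableP; split; first by apply/measurable_EFinP;
  exact: measurable_indic.
under eq_integral do rewrite /= ger0_norm//.
by rewrite integral_indic_itv// ltry.
Qed.

Lemma Rintegral_indic_itv (x y : K) : x <= y ->
  \int[mu]_u \1_(`]x, y]%classic) u = y - x.
Proof. by move=> xy; rewrite /Rintegral integral_indic_itv. Qed.

Lemma integrable_invsqr : mu.-integrable `]1, +oo[ (EFin \o (fun t : K => t^-1 * t^-1)).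
Proof.
have contV (t : K) : 0 < t -> {for t, continuous (fun t : K => t^-1 * t^-1)}.
  move=> t0; apply: cvgM; apply: cvgV; rewrite ?gt_eqF//; exact: cvg_id.
have mf : measurable_fun (`]1, +oo[%classic : set K) (fun t : K => t^-1 * t^-1).
  apply: open_continuous_measurable_fun; first exact: interval_open.
  by move=> t; rewrite inE/= in_itv/= andbT => t1; apply: contV; exact: lt_trans t1.
apply/integrableP; split; first exact/measurable_EFinP.
under eq_integral => t _.
  rewrite /= ger0_norm; last by rewrite -expr2 sqr_ge0.
  over.
rewrite integral_itv_obnd_cbnd; last exact/measurable_EFinP.
have dF (t : K) : 0 < t -> is_derive t 1 (fun t : K => - t^-1) (t^-1 * t^-1).
  move=> t0; have t0' : t != 0 by rewrite gt_eqF.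
  have h : is_derive t 1 (fun t : K => t^-1) (- t ^- 2 *: 1).
    exact: (@is_deriveV _ (@idfun K) t 1 1 t0' (is_derive_id t 1)).
  by apply: is_derive_eq; rewrite /GRing.scale/= mulr1 opprK expr2 invfM.
rewrite (@ge0_continuous_FTC2y _ _ (fun t => - t^-1) 1 0).
- by rewrite -EFinB ltry.
- by move=> t _; rewrite -expr2 sqr_ge0.
- apply: continuous_in_subspaceT => t; rewrite inE/= in_itv/= andbT => t1.
  by apply: contV; exact: lt_le_trans t1.
- rewrite -oppr0; apply: cvgN; apply/gtr0_cvgV0 => //.
  by near=> t; near: t; exact: nbhs_pinfty_gt.
- by move=> t t1; have [] := dF t (lt_trans ltr01 t1).
- have [] := dF 1 ltr01 => /derivable1_diffP/differentiable_continuous h _.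
  by apply: cvg_within_filter; exact: h.
- move=> t; rewrite in_itv/= andbT => t1; rewrite derive1E.
  by have [_ ->] := dF t (lt_trans ltr01 t1).
Unshelve. all: by end_near. Qed.

Variables (W : K -> K) (b : K).
Hypothesis b0 : 0 <= b.
Hypothesis W_ni : forall x y, b <= x -> x <= y -> W y <= W x.
Hypothesis iW : mu.-integrable `]b, +oo[ (EFin \o W).

(** A negative value [W x] would keep [|W|] at or above the positive constant [- W x] on a half-line
    of infinite measure. *)
Lemma nonincreasing_integrable_ge0 x : b <= x -> 0 <= W x.
Proof.
move=> bx; rewrite leNgt; apply/negP => Wx0.
have /integrableP[/measurable_EFinP mW Wy] : mu.-integrable `]x, +oo[ (EFin \o W).
  by apply: integrableS iW => //; apply: subset_itvr; rewrite bnd_simp.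
suff : (+oo <= \int[mu]_(t in `]x, +oo[) `|(EFin \o W) t|)%E by rewrite leNgt Wy.
have -> : +oo%E = (\int[mu]_(t in `]x, +oo[) (- W x)%:E)%E :> \bar K.
  rewrite integral_cst//= lebesgue_measure_itv/= ltry addye// gt0_muley//.
  by rewrite lte_fin oppr_gt0.
apply: ge0_le_integral => //.
- by move=> t _; rewrite lee_fin oppr_ge0 ltW.
- by apply/measurable_EFinP; exact: measurableT_comp.
move=> t; rewrite /= in_itv/= andbT => xt; rewrite lee_fin.
have := W_ni bx (ltW xt) => WW.
by rewrite ler0_norm ?lerN2// (le_trans WW)// ltW.
Qed.

(* A shift by the half period [pi / t] changes the sign of the sine, so twice
   the integral is that of [(W u - W (u + pi / t)) sin (u t)] up to a boundary
   term, and the nonnegative differences telescope. *)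
Lemma nonincreasing_sine_tail c t : b <= c -> 0 < t ->
  `|\int[mu]_(u in `]c, +oo[) (W u * sin (u * t))| <= pi * W c / t.
Proof.
move=> bc t0; pose d := pi / t.
have d0 : 0 < d by rewrite divr_gt0// pi_gt0.
have Wc0 : 0 <= W c := nonincreasing_integrable_ge0 bc.
have iWc : mu.-integrable `]c, +oo[ (EFin \o W).
  by apply: integrableS iW => //; apply: subset_itvr; rewrite bnd_simp.
have cdc : c - d <= c by rewrite lerBlDr lerDl ltW.
(* Extension by zero lets the shift act on the whole line. The boundary term arises on []c - d, c]],
   where [V u] is 0 but [V (u + d)] need not be. *)
pose V := W \_ `]c, +oo[.
have iV : mu.-integrable setT (EFin \o V).
  by rewrite -restrict_EFin; apply/(integrable_mkcond _ _).1.
have iVd : mu.-integrable setT (EFin \o (fun u => V (u + d))).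
  apply: (@integrable_measure_preserving _ (fun u => u + d)) => //.
    exact: measurable_shift.
  by move=> *; exact: lebesgue_measure_shift.
have VE u : c < u -> V u = W u by move=> cu; rewrite /V patchE mem_set//= in_itv/= cu.
have V0 u : u <= c -> V u = 0.
  by move=> uc; rewrite /V patchE memNset//= in_itv/= andbT =>
    /(le_lt_trans uc); rewrite ltxx.
have iVs : mu.-integrable setT (EFin \o (fun u => V u * sin (u * t))).
  exact: integrable_mul_sin.
set J := \int[mu]_(u in _) _.
have JV : J = \int[mu]_u (V u * sin (u * t)).
  rewrite /J Rintegral_mkcond; apply: eq_Rintegral => u _.
  by rewrite /V !patchE; case: ifPn => // _; rewrite mul0r.
have JVd : J = \int[mu]_u - (V (u + d) * sin (u * t)).
  rewrite JV -(@Rintegral_measure_preserving _ (fun u => u + d))//; first last.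
  - by move=> *; exact: lebesgue_measure_shift.
  - exact: measurable_shift.
  apply: eq_Rintegral => u _; rewrite -mulrN; congr (_ * _).
  by rewrite mulrDl /d divfK ?gt_eqF// sinDpi.
have iVds : mu.-integrable setT (EFin \o (fun u => V (u + d) * sin (u * t))).
  exact: integrable_mul_sin.
have J2 : 2 * J = \int[mu]_u ((V u - V (u + d)) * sin (u * t)).
  rewrite mulr_natl mulr2n {1}JV JVd.
  have -> : \int[mu]_u - (V (u + d) * sin (u * t)) =
      - \int[mu]_u (V (u + d) * sin (u * t)).
    rewrite -mulN1r -RintegralZl//; apply: eq_Rintegral => u _; by rewrite mulN1r.
  by rewrite -RintegralB//; apply: eq_Rintegral => u _; rewrite mulrBl.
have iind : mu.-integrable setT (EFin \o (fun u => 2 * W c * \1_(`]c - d, c]%classic) u)).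
  by apply: integrable_EFinZ => //; exact: integrable_indic_itv.
have iB := integrable_EFinB (measurableT : measurable (setT : set K)) iV iVd.
(* On []c - d, c]] the difference [V u - V (u + d)] is [- W (u + d)]; since [W (u + d) <= W c],
   adding [2 * W c] makes it dominate its own absolute value. The integrals of [V] and of its shift
   cancel, and [2 * W c * d] remains. *)
have : `|2 * J| <= \int[mu]_u (V u - V (u + d) + 2 * W c * \1_(`]c - d, c]%classic) u).
  rewrite J2; apply: le_trans.
    apply: le_normr_Rintegral => //; exact: integrable_mul_sin.
  apply: le_Rintegral => //.
  - apply: integrable_norm => //; exact: integrable_mul_sin.
  - exact: integrable_EFinD.
  move=> u _; apply: (@le_trans _ _ `|V u - V (u + d)|).
    by rewrite normrM ler_piMr// sin_max.
  rewrite indicE; have [cu|uc] := ltP c u.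
    rewrite !VE ?ltr_wpDr ?(ltW d0)// memNset/=; last first.
      by rewrite in_itv/= => /andP[_ /(lt_le_trans cu)]; rewrite ltxx.
    by rewrite mulr0 addr0 ger0_norm// subr_ge0 W_ni ?(le_trans bc) ?ltW// ltrDl.
  rewrite (V0 u)// sub0r normrN; have [udc|cud] := leP (u + d) c.
    rewrite V0// normr0 oppr0 add0r mulr_ge0//.
    by rewrite mulr_ge0.
  rewrite VE// mem_set/=; last by rewrite in_itv/= uc ltrBlDr cud.
  have h1 : 0 <= W (u + d) by apply: nonincreasing_integrable_ge0;
    rewrite (le_trans bc)// ltW.
  have h2 : W (u + d) <= W c by apply: W_ni => //; exact: ltW.
  by rewrite ger0_norm// mulr1; lra.
rewrite RintegralD// RintegralB// (@Rintegral_measure_preserving _ (fun u =>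
  u + d))//; first last.
- by move=> *; exact: lebesgue_measure_shift.
- exact: measurable_shift.
rewrite subrr add0r RintegralZl//; last exact: integrable_indic_itv.
rewrite Rintegral_indic_itv//.
rewrite normrM ger0_norm ?ler0n// -mulrA ler_pM2l// => h; apply: le_trans h _.
by rewrite /d le_eqVlt; apply/orP; left; apply/eqP; ring.
Qed.

End monotone_sine_transform.

Section monotone_sine_transform_integrable.
Context {K : realType}.
Notation mu := (@lebesgue_measure K).

Variables (W : K -> K) (b : K).
Hypothesis b0 : 0 <= b.
Hypothesis W_ni : forall x y, b <= x -> x <= y -> W y <= W x.
Hypothesis iW : mu.-integrable `]b, +oo[ (EFin \o W).

Let W_ge0 := nonincreasing_integrable_ge0 W_ni iW.
Let H t := \int[mu]_(u in `]b, +oo[) (W u * sin (u * t)).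
Let V := W \_ `]b, +oo[.

Let V_ge0 u : 0 <= V u.
Proof.
rewrite /V patchE; case: ifPn => //; rewrite inE/= in_itv/= andbT => bu.
exact/W_ge0/ltW.
Qed.

Let iV : mu.-integrable setT (EFin \o V).
Proof. by rewrite /V -restrict_EFin; apply/(integrable_mkcond _ _).1. Qed.

Let mV : measurable_fun setT V.
Proof. by have /measurable_EFinP := measurable_int mu iV. Qed.

(* [head (t, u)] is [u V(u)] cut off to [b < u <= b + 1/t] and [0 < t <= 1]. *)
Let head (z : K * K) : K :=
  V z.2 * z.2 * \1_(`]0, 1]%classic) z.1 *
  \1_(`]-oo, 1]%classic) ((z.2 - b) * z.1).

Let mhead : measurable_fun setT head.
Proof.
apply: measurable_funM.
  apply: measurable_funM.
    apply: measurable_funM; last exact: measurable_snd.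
    by apply: (measurableT_comp mV); exact: measurable_snd.
  apply: (@measurableT_comp _ _ _ _ _ _ (\1_(`]0, 1]%classic) : K -> K));
    last exact: measurable_fst.
  exact: measurable_indic.
apply: (@measurableT_comp _ _ _ _ _ _ (\1_(`]-oo, 1]%classic) : K -> K)).
  exact: measurable_indic.
apply: measurable_funM; last exact: measurable_fst.
by apply: measurable_funB; [exact: measurable_snd|exact: measurable_cst].
Qed.

Let V_supp u : ~ b < u -> V u = 0.
Proof. by move=> bu; rewrite /V patchE memNset//= in_itv/= andbT. Qed.

Let head_ge0 z : 0 <= head z.
Proof.
rewrite /head; do 2 apply: mulr_ge0 => //; have [bu|ub] := pselect (b < z.2).
  by rewrite mulr_ge0// (le_trans b0)// ltW.
by rewrite V_supp// mul0r.
Qed.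

(** For fixed [u] the cut-off imposes [t <= 1] and [t <= (u - b)^-1]. In [u = b + (u - b)] the first
    summand is integrated over []0, 1]] and the second over []0, (u - b)^-1]], which gives [b] and
    1. *)
Let head_section (u : K) : (\int[mu]_t (head (t, u))%:E <= ((b + 1) * V u)%:E)%E.
Proof.
have [bu|ub] := pselect (b < u); last first.
  rewrite (eq_integral (cst 0)%E); last first.
    by move=> t _; rewrite /head/= V_supp// !mul0r.
  by rewrite integral0 V_supp// mulr0.
have ub0 : 0 < u - b by rewrite subr_gt0.
pose maj (t : K) : K := V u * b * \1_(`]0, 1]%classic) t +
   V u * (u - b) * \1_(`]0, (u - b)^-1]%classic) t.
have i1 : mu.-integrable setT (EFin \o \1_(`]0, 1%R]%classic)) by exact:
  integrable_indic_itv.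
have i2 : mu.-integrable setT (EFin \o \1_(`]0, (u - b)^-1]%classic)).
  by apply: integrable_indic_itv; rewrite invr_ge0 ltW.
have imaj : mu.-integrable setT (EFin \o maj).
  by apply: integrable_EFinD => //; apply: integrable_EFinZ.
have Emaj : (\int[mu]_t (maj t)%:E = ((b + 1) * V u)%:E)%E.
  rewrite -[LHS]fineK; last exact: integrable_fin_num.
  congr EFin; rewrite -/(Rintegral mu setT maj) RintegralD//;
    [|exact: integrable_EFinZ..].
  rewrite !RintegralZl// !Rintegral_indic_itv// ?invr_ge0 ?(ltW ub0)// !subr0 mulr1.
  by rewrite mulfK ?gt_eqF//; ring.
rewrite -Emaj; apply: ge0_le_integral => //.
- by move=> t _; rewrite lee_fin.
- by apply/measurable_EFinP; apply: (measurableT_comp mhead); exact: measurable_pair2.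
- exact: (measurable_int mu imaj).
move=> t _; rewrite lee_fin /head/maj/=.
have [/andP[t0 t1]|nt] := boolP (0 < t <= 1); last first.
  rewrite [X in _ * X * _](_ : _ = 0); last first.
    by rewrite indicE memNset//= in_itv/=; exact/negP.
  by rewrite mulr0 mul0r addr_ge0// !mulr_ge0// ltW.
rewrite [\1_(`]0, 1]%classic) t](_ : _ = 1);
  last by rewrite indicE mem_set//= in_itv/= t0.
rewrite !mulr1; have [ut|ut] := leP ((u - b) * t) 1; last first.
  rewrite [X in _ * X <= _](_ : _ = 0); last first.
    by rewrite indicE memNset//= in_itv/= leNgt ut.
  by rewrite mulr0 addr_ge0// !mulr_ge0// ltW.
rewrite !indicE !mem_set//= ?in_itv//= ?t0//=; last first.
  by rewrite -ler_pdivlMl// mulr1 in ut.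
by rewrite !mulr1 le_eqVlt; apply/orP; left; apply/eqP; ring.
Qed.

Let Psi t := (\int[mu]_u (head (t, u))%:E)%E.

Let mPsi : measurable_fun setT Psi.
Proof.
have mh : measurable_fun setT (EFin \o head) by exact/measurable_EFinP.
apply: (@measurable_fun_fubini_tonelli_F _ _ _ _ _ mu _ mh) => z.
by rewrite lee_fin.
Qed.

Let Psi_fin : (\int[mu]_t Psi t < +oo)%E.
Proof.
have mh : measurable_fun setT (EFin \o head) by exact/measurable_EFinP.
have -> : (\int[mu]_t Psi t = \int[mu]_u \int[mu]_t (head (t, u))%:E)%E.
  by apply: (@fubini_tonelli _ _ _ _ _ mu mu _ mh) => z; rewrite lee_fin.
apply: (@le_lt_trans _ _ (\int[mu]_u ((b + 1) * V u)%:E)%E).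
  apply: ge0_le_integral => //.
  - by move=> u _; apply: integral_ge0 => t _; rewrite lee_fin.
  - apply: (@measurable_fun_fubini_tonelli_G _ _ _ _ _ mu _ mh) => z.
    by rewrite lee_fin.
  - by apply/measurable_EFinP/measurable_funM => //; exact: measurable_cst.
have i : mu.-integrable setT (EFin \o (fun u =>
  (b + 1) * V u)) by exact: integrable_EFinZ.
exact: (integrable_lty _ i).
Qed.

Let iW_in c : mu.-integrable `]b, c] (EFin \o W).
Proof. by apply: integrableS iW => //; apply: subset_itvl; rewrite bnd_simp. Qed.

(** With [c = b + t^-1], the bound [|sin (u * t)| <= u * t] contributes [Psi t] from []b, c]].
    Beyond [c] the tail estimate contributes [pi * W c / t ^ 2], and [W c / t ^ 2 <= 4 * Psi t]: one
    factor 2 comes from the length of the right half of []b, c]], the other from the lower bound of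
    [u] there. *)
Let H_le_Psi t : 0 < t -> t <= 1 -> (`|H t / t|%:E <= (1 + 4 * pi)%:E * Psi t)%E.
Proof.
move=> t0 t1; pose c := b + t^-1.
have tV0 : 0 < t^-1 by rewrite invr_gt0.
have bc : b < c by rewrite /c ltrDl.
have headE u : head (t, u) = if (b < u) && (u <= c) then W u * u else 0.
  rewrite /head/= indicE mem_set ?mulr1//=; last by rewrite in_itv/= t0.
  have [bu/=|ub/=] := ltP b u; last by rewrite V_supp ?mul0r// => /lt_geF; rewrite ub.
  rewrite /V patchE mem_set//=; last by rewrite in_itv/= bu.
  rewrite indicE; case: ifPn => uc.
    by rewrite mem_set ?mulr1//= in_itv/= -ler_pdivlMr// div1r lerBlDl.
  rewrite memNset ?mulr0//= in_itv/= -ler_pdivlMr// div1r lerBlDl; exact/negP.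
have Psi1 : (\int[mu]_(u in `]b, c]) (W u * u)%:E)%E = Psi t.
  rewrite /Psi integral_mkcond; apply: eq_integral => u _.
  rewrite headE patchE; case: ifPn; first by rewrite inE/= in_itv/= => ->.
  by rewrite notin_setE/= in_itv/= => /negP/negbTE ->.
have WW : mu.-integrable `]b, c] (EFin \o (fun u => W u * u)).
  have := integrable_EFinZ c (measurable_itv _) (iW_in c).
  apply: le_integrable => //.
    by have /measurable_EFinP mW := measurable_int mu (iW_in c);
      apply/measurable_EFinP/measurable_funM.
  move=> u; rewrite /= in_itv/= => /andP[bu uc].
  rewrite lee_fin normrM mulrC normrM ler_wpM2r// !ger0_norm//.
    by rewrite (le_trans b0)// ltW.
  by rewrite (le_trans b0)// ltW// (lt_le_trans bu).
pose P := \int[mu]_(u in `]b, c]) (W u * u).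
have PsiP : Psi t = P%:E by rewrite -Psi1 /P /Rintegral fineK//;
  exact: integrable_fin_num.
rewrite PsiP -EFinM lee_fin.
have HE : H t = \int[mu]_(u in `]b, c]) (W u * sin (u * t)) +
    \int[mu]_(u in `]c, +oo[) (W u * sin (u * t)).
  rewrite -(@Rintegral_itvB _ _ (BRight b) +oo%O c)//.
  - by rewrite /H addrC subrK.
  - exact: integrable_mul_sin.
  - by rewrite bnd_simp ltW.
have head_le : `|\int[mu]_(u in `]b, c]) (W u * sin (u * t))| <= P * t.
  apply: le_trans; first apply: le_normr_Rintegral => //.
    by apply: integrable_mul_sin => //; exact: (iW_in c).
  rewrite /P -RintegralZr//; apply: le_Rintegral => //.
  - by apply: integrable_norm => //; apply: integrable_mul_sin => //;
      exact: (iW_in c).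
  - rewrite (_ : (fun u => W u * u * t) = (fun u => t * (W u * u))).
      exact: integrable_EFinZ.
    by apply/funext => u; exact: mulrC.
  move=> u; rewrite /= in_itv/= => /andP[bu uc].
  rewrite normrM ger0_norm ?W_ge0 ?(ltW bu)// -mulrA ler_wpM2l ?W_ge0 ?(ltW bu)//.
  by apply: norm_sin_le; rewrite mulr_ge0 ?(ltW t0)// (le_trans b0)// ltW.
have tail_le := nonincreasing_sine_tail W_ni iW (ltW bc) t0.
(* On the right half of [`]b, c]], [u >= t^-1 / 2] and [W u >= W c]. *)
have Wc : W c * (t^-1 / 4) * t^-1 <= P.
  pose m := b + t^-1 / 2.
  have mc : m < c by rewrite /m /c ltrD2l ltr_pdivrMr// mulr_natr mulr2n ltrDl.
  have bm : b < m by rewrite /m ltrDl divr_gt0.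
  have muI : (mu `]m, c]%classic = (c - m)%:E)%E.
    by rewrite lebesgue_measure_itv/= lte_fin mc -EFinB.
  have im : mu.-integrable `]m, c] (EFin \o (fun u => W u * u)).
    by apply: integrableS WW => //; apply: subset_itvr; rewrite bnd_simp ltW.
  have : \int[mu]_(u in `]m, c]) (W c * (t^-1 / 2)) <= \int[mu]_(u in `]m, c]) (W u * u).
    apply: le_Rintegral => //.
      apply: measurable_bounded_integrable => //.
      - by rewrite [ltLHS]muI ltry.
      - exact: bounded_cst.
    move=> u; rewrite /= in_itv/= => /andP[mu_ uc].
    rewrite ler_pM ?W_ge0 ?(ltW bc) ?divr_ge0 ?(ltW tV0)//.
      by rewrite W_ni// ltW// (lt_trans bm).
    by move: mu_ b0; rewrite /m; lra.
  rewrite Rintegral_cst// [X in fine X]muI/= => h.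
  have : \int[mu]_(u in `]m, c]) (W u * u) <= P.
    rewrite -(@Rintegral_itvB _ _ (BRight b) (BRight c) m)//; last 2 first.
    - by rewrite bnd_simp ltW.
    - by rewrite bnd_simp ltW.
    rewrite gerBl; apply: Rintegral_ge0 => u; rewrite /= in_itv/= => /andP[bu um].
    by rewrite mulr_ge0 ?W_ge0 ?(ltW bu)// (le_trans b0)// ltW.
  apply: le_trans; apply: le_trans h; rewrite le_eqVlt; apply/orP; left; apply/eqP.
  by rewrite /m /c; field; rewrite gt_eqF.
rewrite normrM (ger0_norm (ltW tV0)) HE.
apply: le_trans (_ : (P * t + pi * W c / t) * t^-1 <= _).
  rewrite ler_wpM2r ?(ltW tV0)//; apply: le_trans (ler_normD _ _) _.
  by rewrite lerD.
have -> : (P * t + pi * W c / t) * t^-1 = P + 4 * pi * (W c * (t^-1 / 4) * t^-1).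
  by field; rewrite gt_eqF.
have -> : (1 + 4 * pi) * P = P + 4 * pi * P by ring.
by rewrite lerD2l ler_wpM2l// mulr_ge0// pi_ge0.
Qed.

Lemma nonincreasing_sine_transform_integrable :
  mu.-integrable `]0, +oo[ (EFin \o (fun t => H t / t)).
Proof.
have cH : continuous H by apply: sine_transform_continuous.
have mH : measurable_fun (`]0, +oo[%classic : set K) (fun t => H t / t).
  apply: measurable_funM.
    by apply: measurable_funTS; apply: continuous_measurable_fun.
  apply: open_continuous_measurable_fun; first exact: interval_open.
  move=> t; rewrite inE/= in_itv/= andbT => t0.
  by apply: cvgV; [rewrite gt_eqF|exact: cvg_id].
have -> : `]0, +oo[%classic = (`]0, 1] `|` `]1, +oo[)%classic :> set K.
  by rewrite -itv_bndbnd_setU// bnd_simp.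
apply: integrable_setU_disj => //.
- apply/disj_setPS => t [/=]; rewrite !in_itv/= => /andP[_ t1] /andP[].
  by rewrite ltNge t1.
- apply/integrableP; split.
    apply/measurable_EFinP; apply: measurable_funS mH => //.
    exact: subset_itvl.
  apply: (@le_lt_trans _ _ (\int[mu]_(t in `]0%R, 1%R]) ((1 + 4 * pi)%:E * Psi t))%E).
    apply: ge0_le_integral => //.
    - apply: measurableT_comp => //; apply/measurable_EFinP.
      by apply: measurable_funS mH => //; exact: subset_itvl.
    - apply: emeasurable_funM; first exact: measurable_cst.
      exact: measurable_funTS.
    - move=> t; rewrite /= in_itv/= => /andP[t0 t1]; exact: H_le_Psi.
  have Psi_ge0 t : (0 <= Psi t)%E.
    by apply: integral_ge0 => u _; rewrite lee_fin.
  have pi4 : 0 <= 1 + 4 * pi :> K by rewrite addr_ge0// mulr_ge0// pi_ge0.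
  rewrite ge0_integralZl//; last exact: measurable_funTS.
  rewrite lte_mul_pinfty ?lee_fin//.
  apply: le_lt_trans Psi_fin; apply: ge0_subset_integral => //.
(* The tail estimate at [c = b] bounds [|H t / t|] by [pi * W b / t ^ 2]. *)
- have := integrable_EFinZ (pi * W b) (measurable_itv _) (@integrable_invsqr K).
  apply: le_integrable => //.
    apply/measurable_EFinP; apply: measurable_funS mH => //.
    by apply: subset_itvr; rewrite bnd_simp.
  move=> t; rewrite /= in_itv/= andbT => t1; rewrite lee_fin.
  have t0 : 0 < t by exact: lt_trans t1.
  apply: le_trans (ler_norm _); rewrite normrM (@ger0_norm _ t^-1) ?invr_ge0 ?(ltW t0)//.
  rewrite mulrA ler_wpM2r ?invr_ge0 ?(ltW t0)//.
  exact: (nonincreasing_sine_tail W_ni iW (lexx b) t0).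
Qed.

End monotone_sine_transform_integrable.

(** * The real-valued case *)

Section real_valued_case.
Context {K : realType}.
Notation mu := (@lebesgue_measure K).
Local Notation A := (`]0, +oo[%classic : set K).

Lemma ae_impl (P Q : K -> Prop) : (forall x, P x -> Q x) ->
  {ae mu, forall x, P x} -> {ae mu, forall x, Q x}.
Proof. by move=> PQ; apply: filterS => //; exact: (ae_filter_ringOfSetsType mu). Qed.

Lemma integrable_ae_eq (B : set K) (f g : K -> K) : measurable B ->
  measurable_fun B g -> mu.-integrable B (EFin \o f) ->
  {ae mu, forall x, B x -> f x = g x} -> mu.-integrable B (EFin \o g).
Proof.
move=> mB mg /integrableP[mf fy] fg; apply/integrableP; split;
  first exact/measurable_EFinP.
suff <- : (\int[mu]_(x in B) `|(EFin \o f) x| = \int[mu]_(x in B) `|(EFin \o g)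
  x|)%E by [].
apply: ae_eq_integral => //; try exact: measurableT_comp.
  by apply: measurableT_comp => //; exact/measurable_EFinP.
by apply: ae_impl fg => x h Bx; rewrite /= h.
Qed.

Lemma Rintegral_ae_eq (B : set K) (f g : K -> K) : measurable B ->
  mu.-integrable B (EFin \o f) -> mu.-integrable B (EFin \o g) ->
  {ae mu, forall x, B x -> f x = g x} ->
  \int[mu]_(x in B) f x = \int[mu]_(x in B) g x.
Proof.
move=> mB intf intg fg; congr fine; apply: ae_eq_integral => //.
- exact: (measurable_int mu intf).
- exact: (measurable_int mu intg).
- by apply: ae_impl fg => x h Bx; rewrite h.
Qed.

Lemma measurable_nonincreasing_on (W : K -> K) (b : K) :
  (forall x y, b <= x -> x <= y -> W y <= W x) -> measurable_fun `]b, +oo[ W.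
Proof.
move=> W_ni; apply: (@eq_measurable_fun _ _ _ _ _ (fun x => W (Num.max b x))).
  by move=> x; rewrite inE/= in_itv/= andbT => bx; rewrite max_r// ltW.
apply: nonincreasing_measurable => // x y xy.
apply: W_ni; first by rewrite le_max lexx.
by rewrite ge_max !le_max lexx xy orbT.
Qed.

Lemma Rintegral_y_cvg (f : K -> K) (x : K) : mu.-integrable `]x, +oo[ (EFin \o f) ->
  \int[mu]_(u in `]x, n%:R]) f u @[n --> \oo] --> \int[mu]_(u in `]x, +oo[) f u.
Proof.
move=> intf; have /measurable_EFinP mf := measurable_int mu intf.
rewrite (Rintegral_mkcond mu `]x, +oo[).
under eq_fun do rewrite Rintegral_mkcond.
apply: (@Rintegral_dominated_cvg _ _ _ _ (fun u => `|(f \_ `]x, +oo[) u|)) => //.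
- move=> n; apply/(measurable_restrictT _ _).1 => //.
  by apply: measurable_funS mf => //; apply: subset_itvl; rewrite bnd_simp.
- exact/(measurable_restrictT _ _).1.
- move=> u _; apply: cvg_near_cst; near=> n; rewrite !patchE.
  rewrite (_ : (u \in `]x, n%:R]%classic) = (u \in `]x, +oo[%classic))//.
  apply/idP/idP; rewrite !inE/= !in_itv/= ?andbT; first by case/andP.
  by move=> ->/=; near: n; exact: nbhs_infty_ger.
- apply: integrable_norm => //.
  by rewrite -restrict_EFin; apply/(integrable_mkcond _ _).1.
- move=> n u _; rewrite !patchE; case: ifPn => un; last by rewrite normr0.
  rewrite mem_set//=; move: un; rewrite inE/= !in_itv/= andbT; by case/andP.
Unshelve. all: by end_near. Qed.

Lemma measurable_divt (h : K -> K) : continuous h ->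
  measurable_fun A (fun t => h t / t).
Proof.
move=> ch; apply: measurable_funM.
  by apply: measurable_funTS; apply: continuous_measurable_fun.
apply: open_continuous_measurable_fun; first exact: interval_open.
move=> t; rewrite inE/= in_itv/= andbT => t0.
by apply: cvgV; [rewrite gt_eqF|exact: cvg_id].
Qed.

(** * Cosine representation of one real component *)

Section representation.
(** To be instantiated by a component [r] of [R], the same component [phi] of the extension of [R'],
    and the tail variation [V] of the complex extension, which controls the increments of both
    components. *)
Variables (r V phi : K -> K) (b : K).
Hypothesis r_even : forall x, r (- x) = r x.
Hypothesis r_lim : r x @[x --> +oo] --> (0 : K).
Hypothesis r_ac : forall a, 0 < a -> abs_cont 0 a r.
Hypothesis r'_L1 : mu.-integrable A (EFin \o derive1 r).
Hypothesis b0 : 0 <= b.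
Hypothesis g_fin : (\int[mu]_(t in `[1%R, +oo[)
  (`|\int[mu]_(x in `[0%R, b]) (derive1 r x * sin (x * t))| / t)%:E < +oo)%E.
Hypothesis V_phi : forall x y, b <= x -> x <= y -> `|phi x - phi y| <= V x - V y.
Hypothesis iV : mu.-integrable `]b, +oo[ (EFin \o V).
Hypothesis phi_r' : {ae mu, forall x, b < x -> phi x = derive1 r x}.

(** Nothing is assumed about the derivative at 0, so 0 is left out; the closed interval of [g_fin]
    differs by a null set. *)
Let g t := \int[mu]_(x in `]0, b]) (derive1 r x * sin (x * t)).

Let ig0b : mu.-integrable `]0, b] (EFin \o derive1 r).
Proof. by apply: integrableS r'_L1 => //; exact: subset_itvl. Qed.

Let ir'b : mu.-integrable `]b, +oo[ (EFin \o derive1 r).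
Proof. by apply: integrableS r'_L1 => //; exact: subset_itvr. Qed.

Let g_integrable : mu.-integrable A (EFin \o (fun t => g t / t)).
Proof.
have cg : continuous g by apply: sine_transform_continuous.
have mg := measurable_divt cg.
have -> : A = (`]0, 1] `|` `]1, +oo[)%classic :> set K.
  by rewrite -itv_bndbnd_setU// bnd_simp.
apply: integrable_setU_disj => //.
- apply/disj_setPS => t [/=]; rewrite !in_itv/= => /andP[_ t1] /andP[].
  by rewrite ltNge t1.
- have fin01 : (mu `]0%R, 1%R]%classic < +oo)%E by rewrite
    lebesgue_measure_itv/= lte_fin ltr01 -EFinB ltry.
  (* On []0, b]], [|sin (u * t)| <= u * t <= b * t], so [C] bounds [|g t / t|]. *)
  pose C := b * \int[mu]_(x in `]0, b]) `|derive1 r x|.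
  have iC : mu.-integrable `]0, 1] (EFin \o (fun=> C)).
    by apply: measurable_bounded_integrable => //; exact: bounded_cst.
  apply: le_integrable iC => //.
    by apply/measurable_EFinP; apply: measurable_funS mg => //; exact: subset_itvl.
  move=> t; rewrite /= in_itv/= => /andP[t0 t1]; rewrite lee_fin.
  apply: le_trans (ler_norm _); rewrite normrM normfV (gtr0_norm t0) ler_pdivrMr//.
  apply: le_trans; first by apply: le_normr_Rintegral => //; exact: integrable_mul_sin.
  rewrite /C mulrAC -RintegralZl//; last exact: integrable_norm.
  apply: le_Rintegral => //.
  - by apply: integrable_norm => //; exact: integrable_mul_sin.
  - by apply: integrable_EFinZ => //; exact: integrable_norm.
  move=> u; rewrite /= in_itv/= => /andP[u0 ub].
  rewrite normrM mulrC ler_wpM2r//; apply: le_trans (norm_sin_le _) _.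
    by rewrite mulr_ge0 ?ltW.
  by rewrite ler_wpM2r// ltW.
- have mg1 : measurable_fun (`]1, +oo[%classic : set K) (fun t => g t / t).
    by apply: measurable_funS mg => //; apply: subset_itvr; rewrite bnd_simp.
  apply/integrableP; split; first exact/measurable_EFinP.
  have mgn : measurable_fun (`]1, +oo[%classic : set K) (EFin \o (fun t => `|g t| / t)).
    apply/measurable_EFinP.
    apply: (@eq_measurable_fun _ _ _ _ _ (fun t => `|g t / t|));
      last exact: measurableT_comp.
    move=> t; rewrite inE/= in_itv/= andbT => t1.
    by rewrite normrM normfV (gtr0_norm (lt_trans ltr01 t1)).
  apply: le_lt_trans g_fin; rewrite -integral_itv_obnd_cbnd; last first.
    apply: (@eq_measurable_fun _ _ _ _ _ (EFin \o (fun t => `|g t| / t))) => //.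
    move=> t _; rewrite /= /g Rintegral_itv_obnd_cbnd//; exact: integrable_mul_sin.
  rewrite le_eqVlt; apply/orP; left; apply/eqP; apply: eq_integral => t.
  rewrite inE/= in_itv/= andbT => t1.
  rewrite /g Rintegral_itv_obnd_cbnd; last exact: integrable_mul_sin.
  by rewrite normrM normfV (gtr0_norm (lt_trans ltr01 t1)).
Qed.

Let D := derive1 r \_ A.

Let iD : mu.-integrable setT (EFin \o D).
Proof. by rewrite /D -restrict_EFin; apply/(integrable_mkcond _ _).1. Qed.

Let G t := \int[mu]_u (D u * sin (u * t)).

(* [phi = (Wp - Wm) / 2] with [Wp] and [Wm] nonincreasing. *)
Let Wp x := V x + phi x.
Let Wm x := V x - phi x.

Let Wp_ni x y : b <= x -> x <= y -> Wp y <= Wp x.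
Proof.
move=> bx xy; have := V_phi bx xy; rewrite /Wp ler_norml => /andP[]; lra.
Qed.

Let Wm_ni x y : b <= x -> x <= y -> Wm y <= Wm x.
Proof.
move=> bx xy; have := V_phi bx xy; rewrite /Wm ler_norml => /andP[]; lra.
Qed.

(** Equality almost everywhere does not transfer Borel measurability; that of [phi] comes from
    [phi = Wp - V] with [Wp] monotone. *)
Let iphi : mu.-integrable `]b, +oo[ (EFin \o phi).
Proof.
have /measurable_EFinP mV := measurable_int mu iV.
apply: (integrable_ae_eq _ _ ir'b) => //.
  apply: (@eq_measurable_fun _ _ _ _ _ (fun x => Wp x - V x)).
    by move=> x _; rewrite /Wp; ring.
  by apply: measurable_funB => //; exact: measurable_nonincreasing_on.
by apply: ae_impl phi_r' => x h; rewrite /= in_itv/= andbT => /h.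
Qed.

Let iWp : mu.-integrable `]b, +oo[ (EFin \o Wp).
Proof. exact: integrable_EFinD. Qed.

Let iWm : mu.-integrable `]b, +oo[ (EFin \o Wm).
Proof. exact: integrable_EFinB. Qed.

Let Hp t := \int[mu]_(u in `]b, +oo[) (Wp u * sin (u * t)).
Let Hm t := \int[mu]_(u in `]b, +oo[) (Wm u * sin (u * t)).

Let GE t : G t = g t + (2^-1 * Hp t - 2^-1 * Hm t).
Proof.
have -> : G t = \int[mu]_(u in A) (derive1 r u * sin (u * t)).
  rewrite [RHS]Rintegral_mkcond; apply: eq_Rintegral => u _.
  by rewrite /D !patchE; case: ifPn => // _; rewrite mul0r.
have -> : \int[mu]_(u in A) (derive1 r u * sin (u * t)) =
    g t + \int[mu]_(u in `]b, +oo[) (derive1 r u * sin (u * t)).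
  rewrite -(@Rintegral_itvB _ _ (BRight 0) +oo%O b)//.
  - by rewrite addrC subrK.
  - exact: integrable_mul_sin.
congr (_ + _).
rewrite -mulrBr /Hp /Hm -RintegralB//;
  [|exact: integrable_mul_sin|exact: integrable_mul_sin].
rewrite -RintegralZl//; last by apply: integrable_EFinB => //; exact: integrable_mul_sin.
apply: Rintegral_ae_eq => //.
- exact: integrable_mul_sin.
- by apply: integrable_EFinZ => //; apply: integrable_EFinB => //;
    exact: integrable_mul_sin.
apply: ae_impl phi_r' => x h; rewrite /= in_itv/= andbT => /h <-.
by rewrite /Wp /Wm; field.
Qed.

Let iG : mu.-integrable A (EFin \o (fun t => G t / t)).
Proof.
have -> : (fun t => G t / t) = (fun t =>
  g t / t + (2^-1 * (Hp t / t) - 2^-1 * (Hm t / t))).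
  by apply/funext => t; rewrite GE; ring.
apply: integrable_EFinD => //; apply: integrable_EFinB => //;
  apply: integrable_EFinZ => //.
- exact: (nonincreasing_sine_transform_integrable b0 Wp_ni iWp).
- exact: (nonincreasing_sine_transform_integrable b0 Wm_ni iWm).
Qed.

(** The integral over []x, n]] is [r n%:R - r x] by [abs_cont_FTC], and [r] vanishes at infinity. *)
Let r_tail x : 0 <= x -> \int[mu]_(u in `]x, +oo[) D u = - r x.
Proof.
move=> x0; have [_ rE] := abs_cont_FTC r_ac r'_L1.
have ix : mu.-integrable `]x, +oo[ (EFin \o derive1 r).
  by apply: integrableS r'_L1 => //; exact: subset_itvr.
transitivity (\int[mu]_(u in `]x, +oo[) derive1 r u).
  apply: eq_Rintegral => u; rewrite inE/= in_itv/= andbT => xu.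
  by rewrite /D patchE mem_set//= in_itv/= (le_lt_trans x0).
have L1 := Rintegral_y_cvg ix.
have L2 : r n%:R - r x @[n --> \oo] --> 0 - r x.
  apply: cvgB; last exact: cvg_cst.
  by apply: (@cvg_comp _ _ _ (fun n => n%:R) r _ (pinfty_nbhs K)) => //; exact: cvgr_idn.
rewrite -[RHS]sub0r; apply: cvg_unique L1 _ => //.
apply: cvg_trans L2; apply: near_eq_cvg; near=> n.
by rewrite rE//; near: n; exact: nbhs_infty_ger.
Unshelve. all: by end_near. Qed.

(** Chosen so that [kappa * (pi / 2)] is half of [Num.sqrt (2 * pi)], the inverse of the Fourier
    normalisation; the other half will come from the reflected copy of [p]. *)
Let kappa : K := Num.sqrt (2 * pi) / pi.
Let p := (fun t => - kappa * (G t / t)) \_ A.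

Let ip : mu.-integrable setT (EFin \o p).
Proof.
rewrite /p -restrict_EFin; apply/(integrable_mkcond _ _).1 => //.
exact: integrable_EFinZ.
Qed.

(** Both sides are even in [x]. For [x >= 0] the minus sign in [p] cancels the one produced by
    [r_tail]. *)
Let p_cos x : \int[mu]_t (p t * cos (t * x)) = Num.sqrt (2 * pi) / 2 * r x.
Proof.
wlog x0 : x / 0 <= x => [wlog_x0|].
  have [x0|x0] := leP 0 x; first exact: wlog_x0.
  rewrite -r_even -wlog_x0; last by rewrite oppr_ge0 ltW.
  by apply: eq_Rintegral => t _; rewrite mulrN cosN.
transitivity (\int[mu]_(t in A) (- kappa * (G t / t * cos (t * x)))).
  rewrite [RHS]Rintegral_mkcond; apply: eq_Rintegral => t _.
  rewrite /p !patchE; case: ifPn => _; last by rewrite mul0r.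
  by rewrite -!mulrA.
rewrite RintegralZl//; last exact: integrable_mul_cos.
rewrite sine_inversion//; last first.
  by move=> u u0; rewrite /D patchE memNset//= in_itv/= andbT; apply/negP; rewrite -leNgt.
rewrite r_tail// /kappa; move: (Num.sqrt _) => s; move: pi (pi_gt0 K) => q q0.
by field; rewrite gt_eqF.
Qed.

(** In [p t + p (- t)] the cosine integrals add up and the sine integrals cancel. The vanishing sine
    integral is recorded because it keeps the two components of [R] from mixing in the complex
    transform. *)
Lemma even_L1_cosine_representation : exists f : K -> K,
  mu.-integrable setT (EFin \o f) /\ forall x,
    (Num.sqrt (2 * pi))^-1 * (\int[mu]_t (f t * cos (t * x))) = r x /\
    \int[mu]_t (f t * sin (t * x)) = 0.
Proof.
have ipN : mu.-integrable setT (EFin \o (fun t => p (- t))).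
  apply: (integrable_measure_preserving _ _ ip); first exact: oppr_measurable.
  exact: lebesgue_measure_opp.
have refl (h : K -> K) : mu.-integrable setT (EFin \o h) ->
    \int[mu]_t h (- t) = \int[mu]_t h t.
  move=> ih; apply: (Rintegral_measure_preserving _ _ ih); first exact: oppr_measurable.
  exact: lebesgue_measure_opp.
exists (fun t => p t + p (- t)); split; first exact: integrable_EFinD.
move=> x; split.
  under eq_Rintegral do rewrite mulrDl.
  rewrite RintegralD//; [|exact: integrable_mul_cos|exact: integrable_mul_cos].
  have -> : \int[mu]_t (p (- t) * cos (t * x)) = \int[mu]_t (p t * cos (t * x)).
    rewrite -[RHS]refl; last exact: integrable_mul_cos.
    by apply: eq_Rintegral => t _; rewrite mulNr cosN.
  by rewrite p_cos; field; rewrite gt_eqF// sqrtr_gt0 mulr_gt0// pi_gt0.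
under eq_Rintegral do rewrite mulrDl.
rewrite RintegralD//; [|exact: integrable_mul_sin|exact: integrable_mul_sin].
have -> : \int[mu]_t (p (- t) * sin (t * x)) = - \int[mu]_t (p t * sin (t * x)).
  rewrite -mulN1r -RintegralZl//; last exact: integrable_mul_sin.
  rewrite -(refl (fun t => -1 * (p t * sin (t * x)))); last first.
    by apply: integrable_EFinZ => //; exact: integrable_mul_sin.
  by apply: eq_Rintegral => t _; rewrite (mulNr t x) sinN mulrN mulN1r opprK.
by rewrite subrr.
Qed.

End representation.
End real_valued_case.

(** * The complex-valued case *)

Section components.
Context {K : realType}.
Notation mu := (@lebesgue_measure K).

Lemma norm_Re_le_cmod (z : K[i]) : `|complex.Re z| <= cmod z.
Proof.
by case: z => x y; rewrite /cmod/= -sqrtr_sqr ler_wsqrtr// lerDl sqr_ge0.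
Qed.

Lemma norm_Im_le_cmod (z : K[i]) : `|complex.Im z| <= cmod z.
Proof.
by case: z => x y; rewrite /cmod/= -sqrtr_sqr ler_wsqrtr// lerDr sqr_ge0.
Qed.

Lemma cmod_ge0 (z : K[i]) : 0 <= cmod z.
Proof. exact: le_trans (norm_Re_le_cmod z). Qed.

Lemma cmodB (z w : K[i]) : cmod (z - w) = cmod (w - z).
Proof. by case: z w => [x y] [u v]; rewrite /cmod/=; congr Num.sqrt; ring. Qed.

Lemma cmod0 : cmod (0 : K[i]) = 0.
Proof. by rewrite /cmod/= expr0n/= addr0 sqrtr0. Qed.

(** The indexed family is read off the list with [nth]; segments that do not overlap have disjoint
    open interiors. *)
Lemma abs_cont_component (part : K[i] -> K) (a b : K) (f : K -> K[i]) :
  {morph part : z w / z - w} -> (forall z, `|part z| <= cmod z) ->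
  abs_continuous a b f -> abs_cont a b (part \o f).
Proof.
move=> partB part_le ac e e0; have [d d0 H] := ac _ e0; exists d => // s sab sn sd.
pose u (i : 'I_(size s)) := (nth (0, 0) s i).1.
pose v (i : 'I_(size s)) := (nth (0, 0) s i).2.
have := H (size s) u v.
have -> : \sum_(i < size s) (v i - u i) = \sum_(p <- s) (p.2 - p.1).
  by rewrite (big_nth (0, 0)) big_mkord.
move=> {}H; apply: (@le_lt_trans _ _ (\sum_(i < size s) cmod (f (v i) - f (u i)))).
  rewrite (big_nth (0, 0)) big_mkord; apply: ler_sum => i _.
  by rewrite /= -partB.
apply: H => //.
- move=> i; have /allP/(_ (nth (0, 0) s i)) := sab.
  by rewrite mem_nth// => /(_ isT)/and3P.
- apply/trivIsetP => i j _ _; wlog ij : i j / (i < j)%N => [wlog_ij ij|_].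
    have [lij|lji|/val_inj eij] := ltngtP i j.
    + exact: wlog_ij.
    + by rewrite setIC; apply: wlog_ij => //; rewrite eq_sym.
    + by rewrite eij eqxx in ij.
  have := (pairwiseP (0, 0) sn) i j; rewrite !inE => /(_ (ltn_ord i) (ltn_ord j) ij).
  move=> no; apply/seteqP; split => // x [/=]; rewrite !in_itv/= /u /v.
  move=> /andP[x1 x2] /andP[x3 x4]; case/orP: no => h.
    by have := lt_trans x3 (lt_le_trans x2 h); rewrite ltxx.
  by have := lt_trans x1 (lt_le_trans x4 h); rewrite ltxx.
Qed.

(** * Tail variation of a complex-valued function *)

Section tail_variation.
Variables (f : K -> K[i]) (b : K).
Hypothesis TV_fin : (ctotal_variation_infty b f < +oo)%E.
Local Notation TV x := (ctotal_variation_infty x f).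

Lemma ctotal_variation_infty_ge0 x : (0 <= TV x)%E.
Proof.
apply: (@le_trans _ _ (ctotal_variation x x f)).
  apply: ereal_sup_ubound; exists [::]; first by split => /=.
  by rewrite /cvariation big_ord0.
by apply: ereal_sup_ubound; exists x => //; rewrite /= in_itv/= lexx.
Qed.

(** A partition of [[y, c]] preceded by the step from [x] to [y] is a partition of [[x, c]]. *)
Lemma ctotal_variation_infty_step x y : x <= y ->
  ((cmod (f y - f x))%:E + TV y <= TV x)%E.
Proof.
(* Partitions are strictly increasing, so [x = y] is treated apart. *)
rewrite le_eqVlt => /predU1P[<-|xy]; first by rewrite subrr cmod0 add0e.
rewrite -leeBrDl//; apply: ge_ereal_sup => _ [c yc <-].
apply: ge_ereal_sup => _ [s [ps /eqP ls] <-].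
rewrite leeBrDl// -EFinD.
apply: (@le_trans _ _ (ctotal_variation x c f)); last first.
  apply: ereal_sup_ubound; exists c => //; move: yc; rewrite /= !in_itv/= !andbT.
  exact/le_trans/ltW.
apply: ereal_sup_ubound; exists (y :: s); first by split => /=; [rewrite xy|rewrite ls].
by rewrite /cvariation/= big_ord_recl.
Qed.

Lemma ctotal_variation_infty_fin x : b <= x -> TV x \is a fin_num.
Proof.
move=> bx; rewrite ge0_fin_numE ?ctotal_variation_infty_ge0//.
apply: le_lt_trans TV_fin; apply: le_trans (ctotal_variation_infty_step bx).
by rewrite leeDr// lee_fin cmod_ge0.
Qed.

(* Constant to the left of [b], hence monotone on the whole line, which gives
   its measurability. *)
Definition tail_variation x := fine (TV (Num.max b x)).

Lemma tail_variationP x y : b <= x -> x <= y ->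
  cmod (f x - f y) <= tail_variation x - tail_variation y.
Proof.
move=> bx xy; have by_ := le_trans bx xy.
rewrite /tail_variation !max_r//.
have := ctotal_variation_infty_step xy.
rewrite -(fineK (ctotal_variation_infty_fin bx)) -(fineK
  (ctotal_variation_infty_fin by_)).
rewrite -EFinD lee_fin cmodB; lra.
Qed.

Lemma integrable_tail_variation :
  (\int[mu]_(x in `[b, +oo[) TV x < +oo)%E ->
  mu.-integrable `]b, +oo[ (EFin \o tail_variation).
Proof.
move=> TV_int; apply: (@integrableS _ _ _ mu `[b, +oo[%classic) => //.
  by apply: subset_itvr; rewrite bnd_simp.
have mT : measurable_fun setT tail_variation.
  apply: nonincreasing_measurable => // x y xy; rewrite /tail_variation fine_le//.
  - by apply: ctotal_variation_infty_fin; rewrite le_max lexx.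
  - by apply: ctotal_variation_infty_fin; rewrite le_max lexx.
  apply: le_trans (ctotal_variation_infty_step (_ : _ <= Num.max b y)).
    by rewrite leeDr// lee_fin cmod_ge0.
  by rewrite ge_max !le_max lexx xy orbT.
apply/integrableP; split; first by apply/measurable_EFinP; exact: measurable_funTS.
apply: le_lt_trans TV_int; rewrite le_eqVlt; apply/orP; left; apply/eqP.
apply: eq_integral => x; rewrite inE/= in_itv/= andbT => bx.
rewrite ger0_norm /tail_variation max_r// ?fine_ge0 ?ctotal_variation_infty_ge0//.
by rewrite fineK// ctotal_variation_infty_fin.
Qed.

End tail_variation.

Lemma sine_transform_segment_continuous (f : K -> K) (b : K) :
  mu.-integrable `]0, +oo[ (EFin \o f) ->
  continuous (fun t => \int[mu]_(x in `[0, b]) (f x * sin (x * t))).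
Proof.
move=> intf; have if0b : mu.-integrable `]0, b] (EFin \o f).
  by apply: integrableS intf => //; exact: subset_itvl.
rewrite (_ : (fun t => _) = fun t => \int[mu]_(x in `]0, b]) (f x * sin (x * t))).
  exact: sine_transform_continuous.
by apply/funext => t; rewrite Rintegral_itv_obnd_cbnd//; exact: integrable_mul_sin.
Qed.

Lemma cintegral_mul_expi (f h : K -> K) (x : K) :
  mu.-integrable setT (EFin \o f) -> mu.-integrable setT (EFin \o h) ->
  cintegral setT (fun t => (f t +i* h t) * expi (- (x * t))) =
  (\int[mu]_t (f t * cos (t * x)) + \int[mu]_t (h t * sin (t * x))) +i*
  (\int[mu]_t (h t * cos (t * x)) - \int[mu]_t (f t * sin (t * x))).
Proof.
move=> intf inth; rewrite /cintegral; congr (_ +i* _).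
  rewrite -RintegralD//; [|exact: integrable_mul_cos|exact: integrable_mul_sin].
  by apply: eq_Rintegral => t _; rewrite /expi cosN sinN /= (mulrC x t); ring.
rewrite -RintegralB//; [|exact: integrable_mul_cos|exact: integrable_mul_sin].
by apply: eq_Rintegral => t _; rewrite /expi cosN sinN /= (mulrC x t); ring.
Qed.

(* [part] is [Re] or [Im]. *)
Lemma component_representation (part : K[i] -> K) (R R' : K -> K[i]) (b : K)
    (r := part \o R)
    (g := fun t : K =>
       cintegral `[0, b] (fun x => cderive1 R x * (sin (x * t))%:C)) :
  {morph part : z w / z - w} -> (forall z, `|part z| <= cmod z) ->
  (forall x, part (cderive1 R x) = derive1 r x) ->
  (forall t, part (g t) =
     \int[mu]_(x in `[0, b]) (derive1 r x * sin (x * t))) ->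
  (forall x, R (- x) = R x) ->
  cmod (R x) @[x --> +oo] --> (0 : K) ->
  (forall a, 0 < a -> abs_continuous 0 a R) ->
  mu.-integrable `]0, +oo[ (EFin \o derive1 r) ->
  0 <= b ->
  measurable_fun (`[1, +oo[%classic : set K) (fun t => cmod (g t) / t) ->
  (\int[mu]_(t in `[1%R, +oo[) (cmod (g t) / t)%:E < +oo)%E ->
  {ae mu, forall x, b < x -> R' x = cderive1 R x} ->
  (ctotal_variation_infty b R' < +oo)%E ->
  (\int[mu]_(x in `[b, +oo[) ctotal_variation_infty x R' < +oo)%E ->
  exists f : K -> K, mu.-integrable setT (EFin \o f) /\ forall x,
    (Num.sqrt (2 * pi))^-1 * (\int[mu]_t (f t * cos (t * x))) = r x /\
    \int[mu]_t (f t * sin (t * x)) = 0.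
Proof.
move=> partB part_le partE partg R_even R_lim R_ac ir' b0 mg g_fin R'E.
move=> TV_fin TV_int.
have cgr := @sine_transform_segment_continuous _ b ir'.
apply: (@even_L1_cosine_representation K r (tail_variation R' b) (part \o R') b) => //.
- by move=> x; rewrite /r/= R_even.
- apply/cvgr0Pnorm_lt => e e0; move/cvgr0Pnorm_lt/(_ _ e0) : R_lim.
  apply: filterS => x; apply: le_lt_trans.
  by rewrite /r/= (ger0_norm (cmod_ge0 _)).
- by move=> a a0; apply: abs_cont_component => //; exact: R_ac.
(* The comparison of integrals needs both integrands measurable: continuity of the sine transform
   serves the component, [mg] the modulus. *)
- apply: le_lt_trans g_fin; apply: ge0_le_integral => //.
  + move=> t; rewrite /= in_itv/= andbT => t1.
    by rewrite lee_fin divr_ge0// (le_trans ler01).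
  + apply/measurable_EFinP; apply: (@eq_measurable_fun _ _ _ _ _ (fun t =>
      `|(\int[mu]_(x in `[0, b]) (derive1 r x * sin (x * t))) / t|)).
      move=> t; rewrite inE/= in_itv/= andbT => t1.
      by rewrite normrM normfV (gtr0_norm (lt_le_trans ltr01 t1)).
    apply: measurableT_comp => //.
    apply: measurable_funS (measurable_divt cgr) => //.
    by apply: subset_itvr; rewrite bnd_simp.
  + exact/measurable_EFinP.
  + move=> t; rewrite /= in_itv/= andbT => t1; rewrite lee_fin -partg.
    by rewrite ler_wpM2r// invr_ge0 (le_trans ler01).
- move=> x y bx xy; rewrite /= -partB; apply: le_trans (part_le _) _.
  exact: tail_variationP.
- exact: integrable_tail_variation.
- by apply: ae_impl R'E => x h bx; rewrite /= h.
Qed.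

End components.

(** * Components of the complex sine transform, and the theorem *)

Section half_axis_sine_transform.
Context {K : realType}.
Notation mu := (@lebesgue_measure K).
Variables (R : K -> K[i]) (b : K).

Lemma Re_cintegral_sin (t : K) :
  complex.Re (cintegral `[0, b] (fun x => cderive1 R x * (sin (x * t))%:C)) =
  \int[mu]_(x in `[0, b]) (derive1 (@complex.Re K \o R) x * sin (x * t)).
Proof.
by apply: eq_Rintegral => x _; rewrite /cderive1 /= mulr0 subr0.
Qed.

Lemma Im_cintegral_sin (t : K) :
  complex.Im (cintegral `[0, b] (fun x => cderive1 R x * (sin (x * t))%:C)) =
  \int[mu]_(x in `[0, b]) (derive1 (@complex.Im K \o R) x * sin (x * t)).
Proof.
by apply: eq_Rintegral => x _; rewrite /cderive1 /= mulr0 add0r.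
Qed.

(** The modulus is the square root of a sum of squares of two continuous sine transforms. Its
    measurability lets condition (a) pass to the components. *)
Lemma measurable_cmod_cintegral_sin : cintegrable `]0, +oo[ (cderive1 R) ->
  measurable_fun (`[1, +oo[%classic : set K) (fun t =>
     cmod (cintegral `[0, b] (fun x => cderive1 R x * (sin (x * t))%:C)) / t).
Proof.
move=> [iRe iIm].
pose u t := \int[mu]_(x in `[0, b]) (derive1 (@complex.Re K \o R) x * sin (x * t)).
pose v t := \int[mu]_(x in `[0, b]) (derive1 (@complex.Im K \o R) x * sin (x * t)).
have cu : continuous u by exact: sine_transform_segment_continuous.
have cv : continuous v by exact: sine_transform_segment_continuous.
rewrite (_ : (fun t => _) = fun t => Num.sqrt (u t ^+ 2 + v t ^+ 2) / t); last first.
  apply/funext => t; rewrite /u /v -Re_cintegral_sin -Im_cintegral_sin.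
  by case: (cintegral _ _).
have cs : continuous (fun t => Num.sqrt (u t ^+ 2 + v t ^+ 2)).
  move=> t; apply: (@continuous_comp _ _ _ (fun t => u t ^+ 2 + v t ^+ 2) Num.sqrt);
    last exact: sqrt_continuous.
  by apply: cvgD; [apply: cvgM; exact: cu|apply: cvgM; exact: cv].
apply: measurable_funS (measurable_divt cs) => //.
by apply: subset_itvr; rewrite bnd_simp.
Qed.

End half_axis_sine_transform.

Theorem mainTheorem1 (K : realType) (R : K -> K[i])
  (R_even : forall x : K, R (- x) = R x)
  (R_lim : cmod (R x) @[x --> +oo] --> (0 : K))
  (R_ac : forall a : K, 0 < a -> abs_continuous 0 a R)
  (R'_L1 : cintegrable `]0, +oo[ (cderive1 R))
  (R'_b : exists b : K, [/\ 0 <= b,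
     (let g := fun t : K =>
        cintegral `[0, b] (fun x => cderive1 R x * (sin (x * t))%:C) in
      (\int[@lebesgue_measure K]_(t in `[1%R, +oo[) (cmod (g t) / t)%:E
        < +oo)%E) &
     exists R' : K -> K[i],
       [/\ forall x : K, cderivable R x -> R' x = cderive1 R x,
           (ctotal_variation_infty b R' < +oo)%E &
           (\int[@lebesgue_measure K]_(x in `[b, +oo[)
              ctotal_variation_infty x R' < +oo)%E]]) :
  fourier_algebra R.
Proof.
have [b [b0 g_fin [R' [R'E TV_fin TV_int]]]] := R'_b.
have ReB : {morph (@complex.Re K) : z w / z - w} by case=> ? ? [].
have ImB : {morph (@complex.Im K) : z w / z - w} by case=> ? ? [].
have [iRe iIm] := R'_L1.
have mg := measurable_cmod_cintegral_sin b R'_L1.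
have dRe : {ae @lebesgue_measure K, forall x, 0 < x -> derivable (@complex.Re K
  \o R) x 1}.
  have [] := @abs_cont_FTC K (@complex.Re K \o R) _ iRe => // a a0.
  by apply: abs_cont_component => //; [exact: norm_Re_le_cmod|exact: R_ac].
have dIm : {ae @lebesgue_measure K, forall x, 0 < x -> derivable (@complex.Im K
  \o R) x 1}.
  have [] := @abs_cont_FTC K (@complex.Im K \o R) _ iIm => // a a0.
  by apply: abs_cont_component => //; [exact: norm_Im_le_cmod|exact: R_ac].
(* Outside the union of two null sets both components of [R] are derivable, and there the extension
   agrees with the derivative. *)
have R'ae : {ae @lebesgue_measure K, forall x, b < x -> R' x = cderive1 R x}.
  have [N [mN N0 sN]] := dRe; have [M [mM M0 sM]] := dIm.
  exists (N `|` M); split; first exact: measurableU.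
    by rewrite null_set_setU.
  move=> x; apply: contra_notP => /not_orP[Nx Mx] bx; apply: R'E; split.
    by apply: contrapT => h; apply: Nx; apply: sN => /= /(_ (le_lt_trans b0 bx)).
  by apply: contrapT => h; apply: Mx; apply: sM => /= /(_ (le_lt_trans b0 bx)).
have [f [intf fE]] := component_representation ReB (@norm_Re_le_cmod K)
  (fun=> erefl) (Re_cintegral_sin R b) R_even R_lim R_ac iRe b0 mg g_fin R'ae
  TV_fin TV_int.
have [h [inth hE]] := component_representation ImB (@norm_Im_le_cmod K)
  (fun=> erefl) (Im_cintegral_sin R b) R_even R_lim R_ac iIm b0 mg g_fin R'ae
  TV_fin TV_int.
exists (fun t => f t +i* h t); first by split.
apply/funext => x; rewrite /fourier cintegral_mul_expi//.
have [f1 f2] := fE x; have [h1 h2] := hE x.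
(* Without the sine integrals, [f] alone yields the real part and [h] alone the imaginary part. *)
rewrite f2 h2 addr0 subr0.
have -> : R x = complex.Re (R x) +i* complex.Im (R x) by case: (R x).
rewrite -[complex.Re (R x)]f1 -[complex.Im (R x)]h1.
by rewrite /GRing.mul/= !mul0r subr0 addr0.
Qed.
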